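(* Let $x^{i,+}=f^i(x,u)$, $i=1,\ldots,n$, be a nonlinear time-invariant discrete-time system with $\dim(x)=n$, $\dim(u)=m$, smooth $f$ and $\mathrm{rank}(\partial_{(x,u)}f)=n$, considered locally around an equilibrium $(x_0,u_0)$. Then the codistributions $P_1,\ldots,P_{\bar k}$ of the sequence associated with the system by the procedure described in the context are integrable.
   Context: All statements are local, in a suitable neighborhood of an equilibrium $(x_0,u_0)$, i.e. $f(x_0,u_0)=x_0$. Throughout, the dimensions of all considered distributions and codistributions and the ranks of all considered Jacobian matrices are assumed to be locally constant. Spans are over the ring of smooth functions. Integrability: a $p$-dimensional codistribution $P=\mathrm{span}\{\omega^1,\ldots,\omega^p\}$ is integrable if $\mathrm{d}\omega^i\wedge\omega^1\wedge\ldots\wedge\omega^p=0$ for all $i=1,\ldots,p$. Invariance: a codistribution $P$ is invariant w.r.t. a distribution $D$ if the Lie derivative $L_v\omega\in P$ for all 1-forms $\omega\in P$ and all vector fields $v\in D$. For any codistribution $P$ and distribution $D$ there is a unique codistribution of minimal dimension containing $P$ and invariant w.r.t. $D$; it is called the smallest such codistribution. Annihilator: $\mathrm{span}\{\mathrm{d}f\}^\perp$ is the distribution of all vector fields $v$ on the $(x,u)$-manifold with $v\rfloor \mathrm{d}f^i=0$, $i=1,\ldots,n$. Backward-shift: $\delta^{-1}(\omega_i(f(x,u))\,\mathrm{d}f^i)=\omega_i(x)\,\mathrm{d}x^i$; for a codistribution having a basis of 1-forms of the form $\omega_i(f(x,u))\mathrm{d}f^i$, its backward-shift is the codistribution spanned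 by the backward-shifts of these 1-forms. Sequence of codistributions (on the $(n+m)$-dimensional manifold $\mathcal{X}\times\mathcal{U}$ with coordinates $(x,u)$): start with $P_1=\mathrm{span}\{\mathrm{d}x\}$ and for $k\ge 1$ repeat: (1) compute $P_k\cap\mathrm{span}\{\mathrm{d}f\}$; (2) let $P_{k+1}^+$ be the smallest codistribution which is invariant w.r.t. $\mathrm{span}\{\mathrm{d}f\}^\perp$ and contains $P_k\cap\mathrm{span}\{\mathrm{d}f\}$ (it always has a local basis of 1-forms $\omega_i(f(x,u))\mathrm{d}f^i$); (3) set $P_{k+1}=\delta^{-1}(P_{k+1}^+)$. Stop if $P_{\bar k+1}=P_{\bar k}$ for some $k=\bar k$. *)

(* Defs.v *)
From HB Require Import structures.
From mathcomp Require Import all_boot all_order all_algebra all_fingroup.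
From mathcomp Require Import all_classical all_reals all_analysis.

Set Implicit Arguments.
Unset Strict Implicit.
Unset Printing Implicit Defensive.

Import Order.TTheory GRing.Theory Num.Theory.
Import numFieldNormedType.Exports.

Local Open Scope classical_set_scope.
Local Open Scope ring_scope.

(* Everything is local at a point p of R^N.  Functions, vector fields and
   1-forms are total functions standing for their germs at p; hypotheses and
   equalities are only required near p.  In the coordinates y^0, .., y^(N-1) a
   vector field, resp. a 1-form, is the row of its components with respect to
   the d/dy^j, resp. the dy^j. *)
Section LocalCalculus.
Variables (R : realType) (N : nat).
Implicit Types (p y : 'rV[R]_N) (v w : 'rV[R]_N -> 'rV[R]_N).
Implicit Types (P Q D : set ('rV[R]_N -> 'rV[R]_N)).

Definition partial (j : 'I_N) (g : 'rV[R]_N -> R) : 'rV[R]_N -> R :=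
  fun y => 'D_(delta_mx 0 j) g y.

(* On one neighbourhood of p, all the iterated partial derivatives of all the
   entries of F exist and are (Frechet) differentiable. *)
Definition smooth_at a b p (F : 'rV[R]_N -> 'M[R]_(a, b)) : Prop :=
  \forall y \near p, forall i j (s : seq 'I_N),
    differentiable (foldr partial (fun z => F z i j) s) y.

Definition contract (v w : 'rV[R]_N) : R := \sum_j v 0 j * w 0 j.

(* Row i is the 1-form dF^i. *)
Definition differentials a (F : 'rV[R]_N -> 'rV[R]_a) (y : 'rV[R]_N) :
    'M[R]_(a, N) :=
  \matrix_(i, j) partial j (fun z => F z 0 i) y.

Definition lie_form v w : 'rV[R]_N -> 'rV[R]_N := fun y =>
  \row_j \sum_i (v y 0 i * partial i (fun z => w z 0 j) y
                 + w y 0 i * partial j (fun z => v z 0 i) y).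

(* dw = \sum_(i, j) (dw_j/dy^i) dy^i /\ dy^j, evaluated on (a, b). *)
Definition ext_deriv w (y a b : 'rV[R]_N) : R :=
  \sum_i \sum_j partial i (fun z => w z 0 j) y
                * (a 0 i * b 0 j - a 0 j * b 0 i).

(* The (d+2)-form beta /\ w^1 /\ .. /\ w^d, for a 2-form beta and the 1-forms
   w^k given by the rows of W, evaluated on X_0, .., X_(d+1).  The factor 1/2
   comes from the normalization
     (alpha /\ beta)(X) = 1/(k! l!) \sum_s sgn(s) (alpha (x) beta)(X o s). *)
Definition wedge2 d (beta : 'rV[R]_N -> 'rV[R]_N -> R) (W : 'M[R]_(d, N))
    (X : 'I_(2 + d) -> 'rV[R]_N) : R :=
  2^-1 * \sum_(s : 'S_(2 + d)) (-1) ^+ s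
     * beta (X (s (lshift d ord0))) (X (s (lshift d ord_max)))
     * \prod_(k < d) contract (X (s (rshift 2 k))) (row k W).

(* Span over the ring of germs of smooth functions of the rows of W. *)
Definition span_at d p (W : 'rV[R]_N -> 'M[R]_(d, N)) :
    set ('rV[R]_N -> 'rV[R]_N) :=
  [set w | exists2 c : 'rV[R]_N -> 'rV[R]_d, smooth_at p c &
           \forall y \near p, w y = c y *m W y].

(* W is a local basis of P, whose dimension near p is therefore constantly d. *)
Definition local_basis d p (W : 'rV[R]_N -> 'M[R]_(d, N)) P : Prop :=
  [/\ smooth_at p W, \forall y \near p, row_free (W y) & P = span_at p W].

Definition const_dim p P : Prop :=
  exists d (W : 'rV[R]_N -> 'M[R]_(d, N)), local_basis p W P.

(* The fibrewise intersection of P and Q has locally constant dimension (the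
   choice of the bases is immaterial). *)
Definition const_dim_meet p P Q : Prop :=
  exists d e (V : 'rV[R]_N -> 'M[R]_(d, N)) (W : 'rV[R]_N -> 'M[R]_(e, N)),
    [/\ local_basis p V P, local_basis p W Q &
        \forall y \near p, \rank (V y :&: W y)%MS = \rank (V p :&: W p)%MS].

Definition integrable_codist p P : Prop :=
  exists d (W : 'rV[R]_N -> 'M[R]_(d, N)),
    local_basis p W P /\
    forall i, \forall y \near p, forall X,
      wedge2 (ext_deriv (fun z => row i (W z)) y) (W y) X = 0.

(* A codistribution, of possibly nonconstant dimension: a submodule of the
   module of germs of smooth 1-forms. *)
Definition codistribution p P : Prop :=
  (forall w, P w -> smooth_at p w) /\
  (forall d (W : 'rV[R]_N -> 'M[R]_(d, N)),
     (forall i, P (fun y => row i (W y))) -> span_at p W `<=` P).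

Definition invariant_codist P D : Prop :=
  forall v w, D v -> P w -> P (lie_form v w).

Definition smallest_invariant p Q D : set ('rV[R]_N -> 'rV[R]_N) :=
  [set w | forall P, codistribution p P -> Q `<=` P ->
           invariant_codist P D -> P w].

(* The vector fields annihilated by the 1-forms given by the rows of W. *)
Definition annihilator d p (W : 'rV[R]_N -> 'M[R]_(d, N)) :
    set ('rV[R]_N -> 'rV[R]_N) :=
  [set v | smooth_at p v /\
           \forall y \near p, forall i, contract (v y) (row i (W y)) = 0].

End LocalCalculus.

(* The point (x, u) of the state-input space R^n x R^m is row_mx x u. *)
Section Sequence.
Variables (R : realType) (n m : nat).
Variable f : 'rV[R]_(n + m) -> 'rV[R]_n.
Variable p : 'rV[R]_(n + m).

Definition dx (y : 'rV[R]_(n + m)) : 'M[R]_(n, n + m) :=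
  differentials (fun z => lsubmx z) y.

Definition df (y : 'rV[R]_(n + m)) : 'M[R]_(n, n + m) := differentials f y.

(* theta_i(f(x,u)) df^i being a basis of Q, its backward-shift is spanned by
   the theta_i(x) dx^i.  The result does not depend on the basis; it is the
   empty set, and hence not of constant dimension, if Q has no such basis. *)
Definition backward_shift (Q : set ('rV[R]_(n + m) -> 'rV[R]_(n + m))) :
    set ('rV[R]_(n + m) -> 'rV[R]_(n + m)) :=
  [set w | exists d (theta : 'rV[R]_n -> 'M[R]_(d, n)),
     [/\ smooth_at (lsubmx p) theta,
         local_basis p (fun y => theta (f y) *m df y) Q &
         span_at p (fun y => theta (lsubmx y) *m dx y) w]].

Definition codist_plus (P : set ('rV[R]_(n + m) -> 'rV[R]_(n + m))) :=
  smallest_invariant p (P `&` span_at p df) (annihilator p df).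

(* Numbered from 1; index 0 is a duplicate of index 1. *)
Definition codist_seq (k : nat) : set ('rV[R]_(n + m) -> 'rV[R]_(n + m)) :=
  iter k.-1 (fun P => backward_shift (codist_plus P)) (span_at p dx).

Definition constant_dimensions (kbar : nat) : Prop :=
  forall k, (1 <= k <= kbar)%N ->
    [/\ const_dim p (codist_seq k),
        const_dim_meet p (codist_seq k) (span_at p df),
        const_dim p (codist_plus (codist_seq k)) &
        const_dim p (codist_seq k.+1)].

Definition stops_at (kbar : nat) : Prop :=
  [/\ (1 <= kbar)%N, codist_seq kbar.+1 = codist_seq kbar &
      forall k, (1 <= k < kbar)%N -> codist_seq k.+1 <> codist_seq k].

End Sequence.

(* Main.v *)
From mathcomp Require Import all_boot all_order all_algebra all_fingroup.
From mathcomp Require Import all_classical all_reals all_analysis.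
From mathcomp Require Import ring lra.
Require Import Defs.

Set Implicit Arguments.
Unset Strict Implicit.
Unset Printing Implicit Defensive.

Import Order.TTheory GRing.Theory Num.Theory.
Import numFieldNormedType.Exports.

Local Open Scope classical_set_scope.
Local Open Scope ring_scope.

(* Let E be the annihilator of span{df}. Dually, the annihilator of P^+ is the
   largest E-invariant distribution contained in P^perp + E, and it is spanned
   by f-related fields. If v and w are f-related to a and b and lie in
   P^perp + E, they can be corrected by sections of E, which are f-related to 0,
   so as to lie in P^perp, which is involutive; then [v, w] lies in P^perp and
   is f-related to [a, b], hence lies again in the annihilator of P^+. In terms
   of 1-forms: the forms killed by all f-related fields that annihilate the meet
   of P and span{df} form an invariant codistribution containing that meet,
   hence P^+. If theta(f) df is a basis of P^+, this shows that theta kills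
   [a, b] at all points f(y), for any fields a, b in ker theta. As f is a
   submersion with f(p) = x0, these points fill a neighbourhood of x0, so the
   backward-shift of P^+, spanned by theta, is integrable. *)

(** * Partial derivatives *)

(** Lying in P^perp + E is a condition at each point, but the correction by sections of E must be
    smooth. The local constancy of the dimension of the meet makes the rank of the stacked matrix of
    P and df constant, and this yields smooth solutions of the linear system for the corrected
    field. Minimality of P^+ ranges over arbitrary submodules of germs, so the test codistribution
    needs neither a basis nor a constant dimension. The equilibrium matters because P^+ has its
    coefficients over f(x,u) and its backward-shift over x: since f(p) = x0, both are germs at the
    same point and the procedure can be iterated. The property carried along the sequence is not the
    vanishing of (d+2)-forms but that of d(omega) on pairs of vectors killed by the basis, which is
    what brackets of fields detect. *)

Section PartialRules.
Variables (R : realType) (N : nat).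
Implicit Types (y : 'rV[R]_N) (g h : 'rV[R]_N -> R) (j : 'I_N).

Lemma partial_near_eq g h j y :
  (\forall z \near y, g z = h z) -> partial j g y = partial j h y.
Proof. exact: near_eq_derive. Qed.

Lemma partial_cst (c : R) j y : partial j (fun=> c) y = 0.
Proof. exact: derive_cst. Qed.

Lemma partialD g h j y : differentiable g y -> differentiable h y ->
  partial j (fun z => g z + h z) y = partial j g y + partial j h y.
Proof. by move=> dg dh; apply: deriveD; apply: diff_derivable. Qed.

Lemma partialM g h j y : differentiable g y -> differentiable h y ->
  partial j (fun z => g z * h z) y = partial j g y * h y + g y * partial j h y.
Proof.
move=> dg dh; rewrite /partial.
rewrite (@deriveM _ _ g h y); [|exact: diff_derivable..].
by rewrite addrC mulrC.
Qed.

Lemma partialV g j y : differentiable g y -> g y != 0 ->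
  partial j (fun z => (g z)^-1) y = - (partial j g y * (g y)^-1 * (g y)^-1).
Proof.
move=> dg g0; rewrite /partial.
rewrite (@deriveV _ _ g y _ g0); last exact: diff_derivable.
by rewrite /GRing.scale/= expr2 invfM mulNr; congr (- _); ring.
Qed.

Lemma partial_sum (I : finType) (F : I -> 'rV[R]_N -> R) j y :
  (forall i, differentiable (F i) y) ->
  differentiable (fun z => \sum_i F i z) y /\
  partial j (fun z => \sum_i F i z) y = \sum_i partial j (F i) y.
Proof.
move=> dF; elim: (index_enum I) => [|i s [ds IH]].
  have -> : (fun z => \sum_(i <- [::]) F i z) = cst 0.
    by apply/funext => z; rewrite big_nil.
  by rewrite big_nil; split; [exact: differentiable_cst|exact: partial_cst].
have -> : (fun z => \sum_(k <- i :: s) F k z) =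
    (fun z => F i z + \sum_(k <- s) F k z).
  by apply/funext => z; rewrite big_cons.
split; first exact: (@differentiableD _ _ _ (F i)).
by rewrite big_cons -IH partialD.
Qed.

Lemma partial_coord j i y : partial j (fun z => z 0 i) y = (i == j)%:R.
Proof.
rewrite /partial deriveE; last exact: differentiable_coord.
(* The coordinate is packaged as a linear map, which is its own differential. *)
have @l : {linear 'rV[R]_N -> R}.
  by exists (fun M : 'rV[R]_N => M 0 i); do 2![eexists]; do ?[constructor];
     rewrite ?mxE// => ? *; rewrite ?mxE//; move=> ?; rewrite !mxE.
rewrite (_ : (fun _ => _) = l)// diff_lin; last exact: coord_continuous.
by rewrite /l/= mxE eqxx.
Qed.

End PartialRules.

Section ChainRule.
Variables (R : realType) (N M : nat).

Lemma differentiable_row (V : normedModType R) (F : V -> 'rV[R]_M) y :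
  (forall i, differentiable (fun z => F z 0 i) y) -> differentiable F y.
Proof.
move=> dF.
have -> : F = \sum_(i < M) (fun z => F z 0 i *: (delta_mx 0 i : 'rV[R]_M)).
  by apply/funext => z; rewrite fct_sumE {1}(row_sum_delta (F z)).
by apply: differentiable_sum => i; exact: differentiableZl.
Qed.

Lemma diffE_partial (h : 'rV[R]_M -> R) y v : differentiable h y ->
  'd h y v = \sum_r partial r h y * v 0 r.
Proof.
move=> dh; rewrite {1}(row_sum_delta v) linear_sum/=; apply: eq_bigr => r _.
by rewrite linearZ/= -deriveE// [LHS]mulrC.
Qed.

Lemma partial_comp (F : 'rV[R]_N -> 'rV[R]_M) (h : 'rV[R]_M -> R) j y :
  (forall i, differentiable (fun z => F z 0 i) y) ->
  differentiable h (F y) ->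
  differentiable (fun z => h (F z)) y /\
  partial j (fun z => h (F z)) y =
  \sum_r partial r h (F y) * partial j (fun z => F z 0 r) y.
Proof.
move=> dFi dh; have dF := differentiable_row dFi.
split; first exact: (@differentiable_comp _ _ _ _ F h).
rewrite /partial deriveE; last exact: (@differentiable_comp _ _ _ _ F h).
have dFE : 'd F y (delta_mx 0 j) = \row_r partial j (fun z => F z 0 r) y.
  rewrite -deriveE// derive_mx; last exact: diff_derivable.
  by apply/rowP => r; rewrite !mxE.
by rewrite (@diff_comp _ _ _ _ F h)//= dFE diffE_partial//;
  apply: eq_bigr => r _; rewrite mxE.
Qed.

End ChainRule.

(** The first-order expansion at x depends on germs only, so the differential of f also serves for
    g. *)
Lemma near_eq_differentiable (R : realType) (V W : normedModType R)
    (f g : V -> W) x :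
  (\forall z \near x, f z = g z) -> differentiable f x -> differentiable g x.
Proof.
move=> fg /diff_locallyP[df_cont f_expand].
have gexp : g \o shift x = cst (g x) + 'd f x +o_ 0 id.
  apply/eqaddoP => _/posnumP[e].
  move/eqaddoP: f_expand => /(_ e%:num (gt0 e)).
  have fg0 : \forall h \near (0 : V), f (h + x) = g (h + x).
    move: fg; rewrite (near_shift 0 x).
    by apply: filterS => h /=; rewrite subr0.
  apply: filterS2 fg0 => h fgh.
  by rewrite !fctE/= -fgh -(nbhs_singleton fg).
by apply/diff_locallyP; rewrite (diff_unique df_cont gexp).
Qed.

(** Scalar counterpart of [smooth_at]: one neighbourhood serves all orders of differentiation. *)
Definition smooth_fun_at (R : realType) N (p : 'rV[R]_N) (g : 'rV[R]_N -> R) :=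
  \forall y \near p, forall s : seq 'I_N,
    differentiable (foldr (@partial R N) g s) y.

(** * Smooth functions *)

Section SmoothAlgebra.
Variables (R : realType) (N : nat) (U : set 'rV[R]_N).
Variable B : set ('rV[R]_N -> R).
Hypothesis U_open : open U.

(* A set of generators that are differentiable, with partial derivatives in the
   algebra they generate, generates smooth functions only; product, inverse and
   composition are handled without formulas for the higher derivatives. *)
Inductive smooth_algebra : ('rV[R]_N -> R) -> Prop :=
| smooth_algebra_base g : B g -> smooth_algebra g
| smooth_algebra_cst c : smooth_algebra (fun=> c)
| smooth_algebraD g h :
    smooth_algebra g -> smooth_algebra h -> smooth_algebra (fun z => g z + h z)
| smooth_algebraM g h :
    smooth_algebra g -> smooth_algebra h -> smooth_algebra (fun z => g z * h z)
| smooth_algebraV g : smooth_algebra g -> (forall y, U y -> g y != 0) ->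
    smooth_algebra (fun z => (g z)^-1).

Hypothesis B_diff : forall g, B g -> forall y, U y -> differentiable g y.
Hypothesis B_partial : forall g, B g -> forall j,
  exists2 h, smooth_algebra h & forall y, U y -> partial j g y = h y.

Lemma smooth_algebra_diff g : smooth_algebra g ->
  forall y, U y -> differentiable g y.
Proof.
elim=> [{}g|c|{}g h _ dg _ dh|{}g h _ dg _ dh|{}g _ dg g0] y.
- exact: B_diff.
- by move=> _; exact: differentiable_cst.
- by move=> Uy; apply: (@differentiableD _ _ _ g h); [exact: dg|exact: dh].
- by move=> Uy; apply: (@differentiableM _ _ g h); [exact: dg|exact: dh].
- by move=> Uy; apply: (@differentiableV _ _ g); [exact: dg|exact: g0].
Qed.

Lemma smooth_algebra_partial g : smooth_algebra g -> forall j,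
  exists2 h, smooth_algebra h & forall y, U y -> partial j g y = h y.
Proof.
elim=> [{}g /B_partial//|c|{}g h Ag IHg Ah IHh|{}g h Ag IHg Ah IHh|
        {}g Ag IHg g0] j.
- by exists (fun=> 0); [exact: smooth_algebra_cst|
    move=> y _; exact: partial_cst].
- have [g' Ag' gE] := IHg j; have [h' Ah' hE] := IHh j.
  exists (fun z => g' z + h' z); first exact: smooth_algebraD.
  by move=> y Uy; rewrite partialD ?gE ?hE//; exact: smooth_algebra_diff.
- have [g' Ag' gE] := IHg j; have [h' Ah' hE] := IHh j.
  exists (fun z => g' z * h z + g z * h' z).
    by apply: smooth_algebraD; exact: smooth_algebraM.
  by move=> y Uy; rewrite partialM ?gE ?hE//; exact: smooth_algebra_diff.
- have [g' Ag' gE] := IHg j.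
  (* Negation is not a constructor of the algebra, hence the factor -1. *)
  exists (fun z => -1 * ((g' z * (g z)^-1) * (g z)^-1)).
    have Agi := smooth_algebraV Ag g0.
    apply: smooth_algebraM; first exact: smooth_algebra_cst.
    by apply: smooth_algebraM => //; exact: smooth_algebraM.
  move=> y Uy; rewrite partialV ?gE ?g0 ?mulN1r//.
  exact: smooth_algebra_diff.
Qed.

(** By induction on the order, every iterated partial derivative agrees on U with a member of the
    algebra; as U is open, this equality can be differentiated again. *)
Lemma smooth_algebra_smooth g p : smooth_algebra g -> U p ->
  smooth_fun_at p g.
Proof.
move=> Ag Up.
have foldE s : exists2 h, smooth_algebra h &
    forall y, U y -> foldr (@partial R N) g s y = h y.
  elim: s => [|j s [h Ah hE]]; first by exists g.
  have [h' Ah' h'E] := smooth_algebra_partial Ah j.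
  exists h' => //= y Uy; rewrite -h'E//; apply: partial_near_eq.
  by apply: filterS hE _; exact: open_nbhs_nbhs.
have : nbhs p U by exact: open_nbhs_nbhs.
apply: filterS => y Uy s; have [h Ah hE] := foldE s.
have dh := smooth_algebra_diff Ah Uy.
apply: near_eq_differentiable dh.
by apply: filterS (open_nbhs_nbhs (conj U_open Uy)) => z Uz; rewrite hE.
Qed.

End SmoothAlgebra.

Lemma near_open (T : topologicalType) (p : T) (P : set T) :
  (\forall y \near p, P y) -> exists U, [/\ open U, U p & U `<=` P].
Proof.
move=> pP; have : nbhs p P := pP.
by rewrite nbhsE => -[U [oU Up] UP]; exists U.
Qed.

Lemma near_forall (T : topologicalType) (I : finType) (p : T) (P : I -> set T) :
  (forall i, \forall y \near p, P i y) -> \forall y \near p, forall i, P i y.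
Proof. by move=> pP; apply: filter_forall. Qed.

Lemma near_all (T : topologicalType) (p : T) (P : set T) :
  (forall y, P y) -> \forall y \near p, P y.
Proof. by move=> pP; exact: nearW. Qed.

Lemma near_near (T : topologicalType) (p : T) (P : set T) :
  (\forall y \near p, P y) -> \forall y \near p, \forall z \near y, P z.
Proof. by move=> /nbhs_interior. Qed.

Section SmoothFunctions.
Variables (R : realType) (N : nat).
Implicit Types (p y : 'rV[R]_N) (g h : 'rV[R]_N -> R).

Lemma smooth_near p g : smooth_fun_at p g ->
  \forall y \near p, smooth_fun_at y g.
Proof. exact: near_near. Qed.

Lemma smooth_diff p g : smooth_fun_at p g -> differentiable g p.
Proof. by move=> /nbhs_singleton/(_ [::]). Qed.

Lemma smooth_partial p g j : smooth_fun_at p g ->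
  smooth_fun_at p (partial j g).
Proof.
by apply: filterS => y sg s; have := sg (rcons s j); rewrite foldr_rcons.
Qed.

Let smooth_on (U : set 'rV[R]_N) :=
  [set g : 'rV[R]_N -> R | forall y, U y ->
     forall s : seq 'I_N, differentiable (foldr (@partial R N) g s) y].

Let smooth_on_diff U g : smooth_on U g -> forall y, U y -> differentiable g y.
Proof. by move=> sg y Uy; exact: sg Uy [::]. Qed.

Let smooth_on_partial U g j : smooth_on U g -> smooth_on U (partial j g).
Proof.
by move=> sg y Uy s; have := sg _ Uy (rcons s j); rewrite foldr_rcons.
Qed.

(** The functions smooth on U are closed under partial derivatives, so they are admissible
    generators; each closure property below then amounts to one constructor of the algebra. *)
Let smooth_on_algebra U p g : open U -> U p ->
  smooth_algebra U (smooth_on U) g -> smooth_fun_at p g.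
Proof.
move=> oU Up Ag; apply: (smooth_algebra_smooth oU) Ag Up.
- exact: smooth_on_diff.
- move=> {}g sg j; exists (partial j g) => //.
  exact/smooth_algebra_base/smooth_on_partial.
Qed.

Lemma smooth_cst p (c : R) : smooth_fun_at p (fun=> c).
Proof.
apply: (@smooth_on_algebra setT) => //; first exact: openT.
exact: smooth_algebra_cst.
Qed.

Lemma smoothD p g h : smooth_fun_at p g -> smooth_fun_at p h ->
  smooth_fun_at p (fun z => g z + h z).
Proof.
move=> sg sh; have [U [oU Up gh]] := near_open (filterI sg sh).
apply: (smooth_on_algebra oU Up).
by apply: smooth_algebraD; apply: smooth_algebra_base => y /gh[].
Qed.

Lemma smoothM p g h : smooth_fun_at p g -> smooth_fun_at p h ->
  smooth_fun_at p (fun z => g z * h z).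
Proof.
move=> sg sh; have [U [oU Up gh]] := near_open (filterI sg sh).
apply: (smooth_on_algebra oU Up).
by apply: smooth_algebraM; apply: smooth_algebra_base => y /gh[].
Qed.

Lemma smoothV p g : smooth_fun_at p g -> g p != 0 ->
  smooth_fun_at p (fun z => (g z)^-1).
Proof.
move=> sg g0.
have ng0 : \forall y \near p, g y != 0.
  have /differentiable_continuous gc := smooth_diff sg.
  exact: (@cvgr_neq0 _ _ _ _ _ _ _ gc).
have [U [oU Up gh]] := near_open (filterI sg ng0).
apply: (smooth_on_algebra oU Up).
by apply: smooth_algebraV; [apply: smooth_algebra_base|] => y /gh[].
Qed.

(** The generators are the functions that agree on U with a smooth one; on the open set U, their
    partial derivatives are those of the smooth one. *)
Lemma smooth_near_eq p g h : (\forall y \near p, g y = h y) ->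
  smooth_fun_at p g -> smooth_fun_at p h.
Proof.
move=> gh sg; have [U [oU Up hU]] := near_open (filterI gh sg).
apply: (@smooth_algebra_smooth _ _ U [set h' | exists2 g', smooth_on U g' &
  forall y, U y -> g' y = h' y]) => //.
- move=> h' [g' sg' g'h'] y Uy.
  apply: near_eq_differentiable (smooth_on_diff sg' Uy).
  exact: filterS g'h' (open_nbhs_nbhs (conj oU Uy)).
- move=> h' [g' sg' g'h'] j; exists (partial j g').
    apply: smooth_algebra_base; exists (partial j g') => //.
    exact: smooth_on_partial.
  move=> y Uy; apply/esym/partial_near_eq.
  exact: filterS g'h' (open_nbhs_nbhs (conj oU Uy)).
- by apply: smooth_algebra_base; exists g => y /hU[].
Qed.

Lemma smooth_sum (I : Type) (r : seq I) (P : pred I) (F : I -> _ -> R) p :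
  (forall i, P i -> smooth_fun_at p (F i)) ->
  smooth_fun_at p (fun z => \sum_(i <- r | P i) F i z).
Proof.
move=> sF; elim: r => [|i r IH].
  by under eq_fun do rewrite big_nil; exact: smooth_cst.
under eq_fun do rewrite big_cons.
by have [Pi|//] := boolP (P i); apply: smoothD => //; exact: sF.
Qed.

Lemma smooth_prod (I : Type) (r : seq I) (P : pred I) (F : I -> _ -> R) p :
  (forall i, P i -> smooth_fun_at p (F i)) ->
  smooth_fun_at p (fun z => \prod_(i <- r | P i) F i z).
Proof.
move=> sF; elim: r => [|i r IH].
  by under eq_fun do rewrite big_nil; exact: smooth_cst.
under eq_fun do rewrite big_cons.
by have [Pi|//] := boolP (P i); apply: smoothM => //; exact: sF.
Qed.

Lemma smooth_coord p i : smooth_fun_at p (fun z => z 0 i).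
Proof.
pose coords := [set g : 'rV[R]_N -> R | exists i : 'I_N, g = fun z => z 0 i].
apply: (@smooth_algebra_smooth _ _ setT coords) => //.
- exact: openT.
- by move=> g [k ->] y _; exact: differentiable_coord.
- move=> g [k ->] j; exists (fun=> (k == j)%:R); first exact: smooth_algebra_cst.
  by move=> y _; rewrite partial_coord.
- by apply: smooth_algebra_base; exists i.
Qed.

End SmoothFunctions.

(** The generators are of two kinds, compositions [k (F z)] with k smooth along F(U), and functions
    smooth on U. The chain rule writes a partial derivative of the first kind as a sum of products
    of both kinds. *)
Lemma smooth_comp (R : realType) N M (p : 'rV[R]_N) (F : 'rV[R]_N -> 'rV[R]_M)
    (h : 'rV[R]_M -> R) :
  (forall i, smooth_fun_at p (fun z => F z 0 i)) -> smooth_fun_at (F p) h ->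
  smooth_fun_at p (fun z => h (F z)).
Proof.
move=> sF sh.
have Fc : {for p, continuous F}.
  by apply/differentiable_continuous/differentiable_row => i; exact: smooth_diff.
have hF : \forall y \near p, forall s : seq 'I_M,
    differentiable (foldr (@partial R M) h s) (F y) by exact: Fc sh.
have sF' : \forall y \near p, forall i, forall s : seq 'I_N,
    differentiable (foldr (@partial R N) (fun z => F z 0 i) s) y.
  exact: near_forall.
have [U [oU Up hU]] := near_open (filterI hF sF').
pose B := [set g : 'rV[R]_N -> R |
  (exists2 k : 'rV[R]_M -> R, g = (fun z => k (F z)) & forall y, U y ->
    forall s : seq 'I_M, differentiable (foldr (@partial R M) k s) (F y)) \/
  forall y, U y -> forall s : seq 'I_N,
    differentiable (foldr (@partial R N) g s) y].
apply: (@smooth_algebra_smooth _ _ U B) => //.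
- move=> g [[k -> sk]|sg] y Uy; last exact: sg Uy [::].
  apply: (@differentiable_comp _ _ _ _ F k); last exact: sk Uy [::].
  by apply: differentiable_row => i; have [_ /(_ i [::])] := hU _ Uy.
- move=> g [[k -> sk]|sg] j.
    exists (fun z => \sum_r partial r k (F z) * partial j (fun z => F z 0 r) z).
      suff sum_alg (s : seq 'I_M) : smooth_algebra U B (fun z => \sum_(r <- s)
          partial r k (F z) * partial j (fun z => F z 0 r) z) by exact: sum_alg.
      elim: s => [|r s IH].
        by under eq_fun do rewrite big_nil; exact: smooth_algebra_cst.
      under eq_fun do rewrite big_cons.
      apply: smooth_algebraD IH; apply: smooth_algebraM; apply: smooth_algebra_base.
        left; exists (partial r k) => // y Uy s'.
        by have := sk _ Uy (rcons s' r); rewrite foldr_rcons.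
      right => y Uy s'; have [_ /(_ r (rcons s' j))] := hU _ Uy.
      by rewrite foldr_rcons.
    move=> y Uy; have [_ sFy] := hU _ Uy.
    by have [] := @partial_comp R N M F k j y (fun i => sFy i [::]) (sk _ Uy [::]).
  exists (partial j g) => //; apply: smooth_algebra_base; right => y Uy s.
  by have := sg _ Uy (rcons s j); rewrite foldr_rcons.
- by apply: smooth_algebra_base; left; exists h => // y /hU[].
Qed.

(** * Symmetry of second derivatives *)

Section Schwarz.
Variables (R : realType) (V : normedModType R).
Implicit Types (g : V -> R) (q u v : V).

Lemma is_derive_line g q u (t : R) : differentiable g (q + t *: u) ->
  is_derive t 1 (fun s : R => g (q + s *: u)) ('D_u g (q + t *: u)).
Proof.
move=> dg; have dgu : derivable g (q + t *: u) u by exact: diff_derivable.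
have quotE :
    (fun h : R => h^-1 *: (g (q + (h *: 1 + t) *: u) - g (q + t *: u))) =
    (fun h => h^-1 *: (g (h *: u + (q + t *: u)) - g (q + t *: u))).
  apply/funext => h; congr (_ *: (g _ - _)).
  by rewrite scalerDl [h *: 1]mulr1 addrCA.
by split; rewrite /derivable /derive quotE.
Qed.

Lemma MVT_line g q u (h : R) : 0 < h ->
  (forall t, 0 <= t <= h -> differentiable g (q + t *: u)) ->
  exists2 t, 0 < t < h & g (q + h *: u) - g q = h * 'D_u g (q + t *: u).
Proof.
move=> h0 dg.
have [t|t t0h|t] := @MVT R (fun s => g (q + s *: u))
    (fun s => 'D_u g (q + s *: u)) 0 h h0.
- rewrite in_itv/= => /andP[t0 th]; apply: is_derive_line.
  by apply: dg; rewrite !ltW.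
- apply: derivable_within_continuous => s; rewrite in_itv/= => sh.
  exact: (@ex_derive _ _ _ _ _ _ _ (is_derive_line (dg _ sh))).
- rewrite in_itv/= => th; rewrite scale0r addr0 subr0 => ->.
  by exists t => //; rewrite mulrC.
Qed.

Lemma differentiable_shift g c q : differentiable g (q + c) ->
  differentiable (fun z => g (z + c)) q.
Proof.
move=> dg; apply: (@differentiable_comp _ _ _ _ (fun z => z + c) g) => //.
Qed.

Lemma derive_line_shift g c q u : 'D_u (fun z => g (z + c)) q = 'D_u g (q + c).
Proof.
rewrite /derive (_ : (fun h : R => h^-1 *: (g (h *: u + q + c) - _)) =
  (fun h => h^-1 *: (g (h *: u + (q + c)) - g (q + c))))//.
by apply/funext => h; rewrite addrA.
Qed.

(** The mean value theorem is used twice: for the increment of g by h v along u, then for the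
    derivative of g in the direction u along v. *)
Lemma second_difference g q u v (h : R) : 0 < h ->
  (forall s t, 0 <= s <= h -> 0 <= t <= h ->
    differentiable g (q + s *: u + t *: v) /\
    differentiable ('D_u g) (q + s *: u + t *: v)) ->
  exists s t, [/\ 0 < s < h, 0 < t < h &
    g (q + h *: u + h *: v) - g (q + h *: u) - g (q + h *: v) + g q =
    h * (h * 'D_v ('D_u g) (q + s *: u + t *: v))].
Proof.
move=> h0 dg; have hh : 0 <= h <= h by rewrite lexx ltW.
have h00 : 0 <= (0 : R) <= h by rewrite lexx ltW.
pose k z := g (z + h *: v) - g z.
have dk s : 0 <= s <= h -> differentiable k (q + s *: u).
  move=> sh; have [dg1 _] := dg _ _ sh hh; have [dg0 _] := dg _ _ sh h00.
  move: dg0; rewrite scale0r addr0 => dg0.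
  apply: (@differentiableB _ _ _ (fun z => g (z + h *: v)) g) => //.
  exact: differentiable_shift.
have [s sh kE] := MVT_line h0 dk.
have sh' : 0 <= s <= h by case/andP: sh => s0 s1; rewrite !ltW.
have DkE : 'D_u k (q + s *: u) =
    'D_u g (q + s *: u + h *: v) - 'D_u g (q + s *: u).
  have [dg1 _] := dg _ _ sh' hh; have [dg0 _] := dg _ _ sh' h00.
  move: dg0; rewrite scale0r addr0 => dg0.
  rewrite (@deriveB _ _ _ (fun z => g (z + h *: v)) g).
  - by rewrite derive_line_shift.
  - exact/diff_derivable/differentiable_shift.
  - exact: diff_derivable.
have dl t : 0 <= t <= h -> differentiable ('D_u g) (q + s *: u + t *: v).
  by move=> th; have [] := dg _ _ sh' th.
have [t th lE] := MVT_line h0 dl.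
exists s, t; split => //; rewrite -lE -DkE -kE /k; ring.
Qed.

(** The second difference is symmetric in u and v, so the two mixed derivatives take a common value
    at two points arbitrarily close to p; continuity brings this to p. *)
Lemma derive_comm g p u v :
  (\forall y \near p, [/\ differentiable g y, differentiable ('D_u g) y &
     differentiable ('D_v g) y]) ->
  {for p, continuous ('D_v ('D_u g))} -> {for p, continuous ('D_u ('D_v g))} ->
  'D_v ('D_u g) p = 'D_u ('D_v g) p.
Proof.
move=> dg cvu cuv; apply/eqP; rewrite -subr_eq0 -normr_le0.
apply/ler_addgt0Pr => e e0; rewrite add0r.
have e20 : 0 < e / 2 by rewrite divr_gt0.
have /cvgrPdist_lt/(_ _ e20) nvu := cvu.
have /cvgrPdist_lt/(_ _ e20) nuv := cuv.
have /nbhs_ballP[r /= r0 rP] : \forall y \near p,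
   [/\ differentiable g y, differentiable ('D_u g) y & differentiable ('D_v g) y] /\
   (`|'D_v ('D_u g) p - 'D_v ('D_u g) y| < e / 2 /\
    `|'D_u ('D_v g) p - 'D_u ('D_v g) y| < e / 2).
  exact: (filterI dg (filterI nvu nuv)).
(* Small enough for the parallelogram with sides h u and h v to stay in the ball; the summand 1
   keeps the denominator positive when u and v vanish. *)
pose h := r / (1 + `|u| + `|v|) / 2.
have c0 : 0 < 1 + `|u| + `|v| by rewrite -addrA ltr_pwDl// addr_ge0.
have h0 : 0 < h by rewrite !divr_gt0.
have hr : h * (`|u| + `|v|) < r.
  rewrite /h mulrAC ltr_pdivrMr// mulrAC ltr_pdivrMr//.
  rewrite -mulrA ltr_pM2l//; lra.
have inball s t : 0 <= s <= h -> 0 <= t <= h -> ball p r (p + s *: u + t *: v).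
  move=> /andP[s0 sh] /andP[t0 th]; rewrite -ball_normE/= -addrA opprD addNKr.
  rewrite normrN (le_lt_trans (ler_normD _ _))// !normrZ !ger0_norm//.
  apply: le_lt_trans hr; rewrite mulrDr lerD// ler_wpM2r//.
have [s [t [sh th E1]]] := second_difference h0 (fun s t sh th =>
  let: conj (And3 a b c) _ := rP _ (inball s t sh th) in conj a b).
have inball' s' t' : 0 <= s' <= h -> 0 <= t' <= h ->
    ball p r (p + s' *: v + t' *: u).
  by move=> ? ?; rewrite addrAC; exact: inball.
have [s' [t' [sh' th' E2]]] := second_difference h0 (fun s t sh th =>
  let: conj (And3 a b c) _ := rP _ (inball' s t sh th) in conj a c).
have itvW (x : R) : 0 < x < h -> 0 <= x <= h by case/andP => ? ?; rewrite !ltW.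
have [_ [n1 _]] := rP _ (inball s t (itvW _ sh) (itvW _ th)).
have [_ [_ n2]] := rP _ (inball' s' t' (itvW _ sh') (itvW _ th')).
have cuv' : p + h *: u + h *: v = p + h *: v + h *: u by exact: addrAC.
have E : 'D_v ('D_u g) (p + s *: u + t *: v) =
         'D_u ('D_v g) (p + s' *: v + t' *: u).
  apply: (mulfI (lt0r_neq0 h0)); apply: (mulfI (lt0r_neq0 h0)).
  apply: (etrans (esym E1)); apply: (etrans _ E2); rewrite -cuv'.
  by move: (g (p + h *: u + h *: v)) (g _) (g _) (g p) => a b c d; ring.
rewrite -E in n2.
have triangle (a b x : R) :
    `|a - x| < e / 2 -> `|b - x| < e / 2 -> `|a - b| <= e.
  rewrite [`|b - x|]distrC => ax xb.
  by rewrite (splitr e) (le_trans (ler_distD x _ _))// lerD ?ltW.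
exact: triangle n1 n2.
Qed.

End Schwarz.

(** * Smooth matrix-valued functions *)

Section SmoothMatrices.
Variables (R : realType) (N : nat) (p : 'rV[R]_N).

Lemma smooth_atP a b (F : 'rV[R]_N -> 'M[R]_(a, b)) :
  smooth_at p F <-> forall i j, smooth_fun_at p (fun z => F z i j).
Proof.
split=> [sF i j|sF]; first by apply: filterS sF => y; apply.
have : \forall y \near p, forall i j, forall s : seq 'I_N,
    differentiable (foldr (@partial R N) (fun z => F z i j) s) y.
  by apply: near_forall => i; apply: near_forall => j; exact: sF.
by apply: filterS => y sy i j s; exact: sy.
Qed.

Lemma smooth_at_near_eq a b (F G : 'rV[R]_N -> 'M[R]_(a, b)) :
  (\forall y \near p, F y = G y) -> smooth_at p F -> smooth_at p G.
Proof.
move=> FG /smooth_atP sF; apply/smooth_atP => i j.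
by apply: smooth_near_eq (sF i j); apply: filterS FG => y ->.
Qed.

Lemma smooth_at_cst a b (M : 'M[R]_(a, b)) : smooth_at p (fun=> M).
Proof. by apply/smooth_atP => i j; exact: smooth_cst. Qed.

Lemma smooth_atD a b (F G : 'rV[R]_N -> 'M[R]_(a, b)) :
  smooth_at p F -> smooth_at p G -> smooth_at p (fun z => F z + G z).
Proof.
move=> /smooth_atP sF /smooth_atP sG; apply/smooth_atP => i j.
by under eq_fun do rewrite mxE; exact: smoothD.
Qed.

Lemma smooth_atM a b c (F : 'rV[R]_N -> 'M[R]_(a, b))
    (G : 'rV[R]_N -> 'M[R]_(b, c)) :
  smooth_at p F -> smooth_at p G -> smooth_at p (fun z => F z *m G z).
Proof.
move=> /smooth_atP sF /smooth_atP sG; apply/smooth_atP => i j.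
under eq_fun do rewrite mxE; apply: smooth_sum => k _; exact: smoothM.
Qed.

Lemma smooth_atN a b (F : 'rV[R]_N -> 'M[R]_(a, b)) :
  smooth_at p F -> smooth_at p (fun z => - F z).
Proof.
move=> /smooth_atP sF; apply/smooth_atP => i j.
under eq_fun do rewrite mxE -mulN1r; apply: smoothM => //; exact: smooth_cst.
Qed.

Lemma smooth_at_mxsub a b a' b' (r : 'I_a' -> 'I_a) (c : 'I_b' -> 'I_b)
    (F : 'rV[R]_N -> 'M[R]_(a, b)) :
  smooth_at p F -> smooth_at p (fun z => mxsub r c (F z)).
Proof.
move=> /smooth_atP sF; apply/smooth_atP => i j.
by under eq_fun do rewrite mxE.
Qed.

Lemma smooth_at_row a b (F : 'rV[R]_N -> 'M[R]_(a, b)) i :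
  smooth_at p F -> smooth_at p (fun z => row i (F z)).
Proof.
by move=> /smooth_atP sF; apply/smooth_atP => k j; under eq_fun do rewrite mxE.
Qed.

Lemma smooth_at_rows a b (F : 'rV[R]_N -> 'M[R]_(a, b)) :
  (forall i, smooth_at p (fun z => row i (F z))) -> smooth_at p F.
Proof.
move=> sF; apply/smooth_atP => i j.
by have /smooth_atP/(_ 0 j) := sF i; under eq_fun do rewrite mxE.
Qed.

Lemma smooth_at_tr a b (F : 'rV[R]_N -> 'M[R]_(a, b)) :
  smooth_at p F -> smooth_at p (fun z => (F z)^T).
Proof.
by move=> /smooth_atP sF; apply/smooth_atP => i j; under eq_fun do rewrite mxE.
Qed.

Lemma smooth_at_col_mx a b c (F : 'rV[R]_N -> 'M[R]_(a, c))
    (G : 'rV[R]_N -> 'M[R]_(b, c)) :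
  smooth_at p F -> smooth_at p G -> smooth_at p (fun z => col_mx (F z) (G z)).
Proof.
move=> /smooth_atP sF /smooth_atP sG; apply/smooth_atP => i j.
case: (splitP i) => k ik.
  have -> : i = lshift b k by exact: val_inj.
  by under eq_fun do rewrite col_mxEu.
have -> : i = rshift a k by exact: val_inj.
by under eq_fun do rewrite col_mxEd.
Qed.

Lemma smooth_det a (F : 'rV[R]_N -> 'M[R]_a) :
  smooth_at p F -> smooth_fun_at p (fun z => \det (F z)).
Proof.
move=> /smooth_atP sF; apply: smooth_sum => s _; apply: smoothM.
  exact: smooth_cst.
by apply: smooth_prod => i _; exact: sF.
Qed.

Lemma near_unitmx a (F : 'rV[R]_N -> 'M[R]_a) :
  smooth_at p F -> F p \in unitmx -> \forall y \near p, F y \in unitmx.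
Proof.
move=> sF; rewrite unitmxE unitfE => Fp.
have /differentiable_continuous detc := smooth_diff (smooth_det sF).
have : \forall y \near p, \det (F y) != 0.
  exact: (@cvgr_neq0 _ _ _ _ _ _ _ detc Fp).
by apply: filterS => y; rewrite unitmxE unitfE.
Qed.

(** Cramer's rule: near p the inverse is the adjugate divided by the determinant, both polynomial in
    the entries. *)
Lemma smooth_at_invmx a (F : 'rV[R]_N -> 'M[R]_a) :
  smooth_at p F -> F p \in unitmx -> smooth_at p (fun z => invmx (F z)).
Proof.
move=> sF Fp; have nF := near_unitmx sF Fp.
apply: (@smooth_at_near_eq _ _ (fun z => (\det (F z))^-1 *: \adj (F z))).
  by apply: filterS nF => y uF; rewrite /invmx uF.
apply/smooth_atP => i j; under eq_fun do rewrite !mxE.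
apply: smoothM.
  by apply: smoothV; [exact: smooth_det|rewrite -unitfE -unitmxE].
apply: smoothM; first exact: smooth_cst.
apply: smooth_det; apply/smooth_atP => k l.
under eq_fun do rewrite !mxE.
by move/smooth_atP : sF; apply.
Qed.

Lemma smooth_differentials a (F : 'rV[R]_N -> 'rV[R]_a) :
  smooth_at p F -> smooth_at p (differentials F).
Proof.
move=> /smooth_atP sF; apply/smooth_atP => i j.
by under eq_fun do rewrite mxE; exact: smooth_partial.
Qed.

Lemma smooth_at_continuous a (F : 'rV[R]_N -> 'rV[R]_a) :
  smooth_at p F -> {for p, continuous F}.
Proof.
move=> /smooth_atP sF; apply/differentiable_continuous/differentiable_row => i.
exact: smooth_diff.
Qed.

End SmoothMatrices.

Lemma smooth_at_comp (R : realType) N M a b (p : 'rV[R]_N)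
    (f : 'rV[R]_N -> 'rV[R]_M) (F : 'rV[R]_M -> 'M[R]_(a, b)) :
  smooth_at p f -> smooth_at (f p) F -> smooth_at p (fun z => F (f z)).
Proof.
move=> /smooth_atP sf /smooth_atP sF; apply/smooth_atP => i j.
exact: (smooth_comp (h := fun z => F z i j)).
Qed.

(** * Lie calculus *)

Section LieCalculus.
Variables (R : realType) (N : nat).
Implicit Types (p y : 'rV[R]_N) (g h : 'rV[R]_N -> R).
Implicit Types (v w om : 'rV[R]_N -> 'rV[R]_N).

Lemma contractE (a b : 'rV[R]_N) : contract a b = (a *m b^T) 0 0.
Proof. by rewrite mxE; apply: eq_bigr => j _; rewrite mxE. Qed.

Lemma contractC (a b : 'rV[R]_N) : contract a b = contract b a.
Proof. by apply: eq_bigr => j _; rewrite mulrC. Qed.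

Lemma smooth_contract p v w : smooth_at p v -> smooth_at p w ->
  smooth_fun_at p (fun z => contract (v z) (w z)).
Proof.
move=> /smooth_atP sv /smooth_atP sw.
by apply: smooth_sum => j _; exact: smoothM.
Qed.

Definition directional v g y := \sum_i v y 0 i * partial i g y.

Definition lie_bracket v w : 'rV[R]_N -> 'rV[R]_N := fun y =>
  \row_i (directional v (fun z => w z 0 i) y -
          directional w (fun z => v z 0 i) y).

Lemma smooth_directional p v g : smooth_at p v -> smooth_fun_at p g ->
  smooth_fun_at p (directional v g).
Proof.
move=> /smooth_atP sv sg; apply: smooth_sum => i _.
by apply: smoothM => //; exact: smooth_partial.
Qed.

Lemma smooth_lie_bracket p v w : smooth_at p v -> smooth_at p w ->
  smooth_at p (lie_bracket v w).
Proof.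
move=> sv sw; have /smooth_atP sv' := sv; have /smooth_atP sw' := sw.
apply/smooth_atP => k i; under eq_fun do rewrite mxE -mulN1r.
apply: smoothD; first exact: smooth_directional.
apply: smoothM; first exact: smooth_cst.
exact: smooth_directional.
Qed.

Lemma smooth_lie_form p v w : smooth_at p v -> smooth_at p w ->
  smooth_at p (lie_form v w).
Proof.
move=> /smooth_atP sv /smooth_atP sw; apply/smooth_atP => k j.
under eq_fun do rewrite mxE; apply: smooth_sum => i _.
by apply: smoothD; apply: smoothM => //; apply: smooth_partial.
Qed.

Lemma directional_near_eq v g h y : (\forall z \near y, g z = h z) ->
  directional v g y = directional v h y.
Proof. by move=> gh; apply: eq_bigr => i _; rewrite (partial_near_eq _ gh). Qed.

Lemma directional_near0 v g y : (\forall z \near y, g z = 0) ->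
  directional v g y = 0.
Proof.
move=> g0; rewrite (directional_near_eq v g0) /directional big1// => i _.
by rewrite partial_cst mulr0.
Qed.

Lemma directional_contract v om w y : smooth_at y om -> smooth_at y w ->
  directional v (fun z => contract (om z) (w z)) y =
  \sum_i \sum_j v y 0 i * (partial i (fun z => om z 0 j) y * w y 0 j +
                           om y 0 j * partial i (fun z => w z 0 j) y).
Proof.
move=> /smooth_atP so /smooth_atP sw; apply: eq_bigr => i _.
have [|_ ->] := @partial_sum R N _ (fun j z => om z 0 j * w z 0 j) i y.
  by move=> j; apply: smooth_diff; exact: smoothM.
rewrite mulr_sumr; apply: eq_bigr => j _.
by rewrite partialM//; exact: smooth_diff.
Qed.

(** Here and in the next two lemmas the partial derivatives are replaced by arbitrary arrays, which
    turns the index computations behind the Leibniz and Cartan formulas into plain algebra of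
    sums. *)
Lemma sum_bracket (v w om : 'I_N -> R) (dv dw : 'I_N -> 'I_N -> R) :
  \sum_j om j * (\sum_i v i * dw i j - \sum_i w i * dv i j) =
  \sum_i \sum_j om j * v i * dw i j - \sum_i \sum_j om j * w i * dv i j.
Proof.
rewrite [X in X - _]exchange_big [X in _ - X]exchange_big/= -sumrB.
apply: eq_bigr => j _; rewrite mulrBr !mulr_sumr.
by congr (_ - _); apply: eq_bigr => i _; rewrite mulrA.
Qed.

Lemma sum_directional (v w om : 'I_N -> R) (dom dw : 'I_N -> 'I_N -> R) :
  \sum_i \sum_j v i * (dom i j * w j + om j * dw i j) =
  \sum_i \sum_j v i * w j * dom i j + \sum_i \sum_j om j * v i * dw i j.
Proof.
rewrite -big_split/=; apply: eq_bigr => i _; rewrite -big_split/=.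
by apply: eq_bigr => j _; ring.
Qed.

Lemma sum_directional_form (v w om : 'I_N -> R) (dom dv : 'I_N -> 'I_N -> R) :
  \sum_j (\sum_i (v i * dom i j + om i * dv j i)) * w j =
  \sum_i \sum_j v i * w j * dom i j + \sum_i \sum_j om j * w i * dv i j.
Proof.
rewrite [X in _ = X + _]exchange_big/= -big_split/=; apply: eq_bigr => j _.
by rewrite -big_split/= mulr_suml; apply: eq_bigr => i _; ring.
Qed.

Lemma contract_lie_bracket om v w y : contract (om y) (lie_bracket v w y) =
  \sum_i \sum_j om y 0 j * v y 0 i * partial i (fun z => w z 0 j) y -
  \sum_i \sum_j om y 0 j * w y 0 i * partial i (fun z => v z 0 j) y.
Proof.
rewrite -(sum_bracket (fun i => v y 0 i) (fun i => w y 0 i) (fun i => om y 0 i)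
  (fun i j => partial i (fun z => v z 0 j) y)
  (fun i j => partial i (fun z => w z 0 j) y)).
by apply: eq_bigr => j _; rewrite mxE.
Qed.

(** Leibniz rule for the Lie derivative: v(om(w)) = (L_v om)(w) + om([v, w]). *)
Lemma contract_lie_form v om w y :
  smooth_at y v -> smooth_at y om -> smooth_at y w ->
  contract (lie_form v om y) (w y) =
  directional v (fun z => contract (om z) (w z)) y -
  contract (om y) (lie_bracket v w y).
Proof.
move=> sv so sw; rewrite directional_contract// contract_lie_bracket.
rewrite (sum_directional (fun i => v y 0 i) (fun i => w y 0 i) (fun i => om y 0 i)
  (fun i j => partial i (fun z => om z 0 j) y)
  (fun i j => partial i (fun z => w z 0 j) y)).
rewrite opprB [X in _ = _ + X]addrC addrA addrK -sum_directional_form.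
by apply: eq_bigr => j _; rewrite mxE.
Qed.

(** Cartan's formula; the terms with derivatives of v and w cancel against the bracket. *)
Lemma ext_deriv_lie_bracket v om w y :
  smooth_at y v -> smooth_at y om -> smooth_at y w ->
  ext_deriv om y (v y) (w y) =
  directional v (fun z => contract (om z) (w z)) y -
  directional w (fun z => contract (om z) (v z)) y -
  contract (om y) (lie_bracket v w y).
Proof.
move=> sv so sw; rewrite !directional_contract// contract_lie_bracket.
rewrite (sum_directional (fun i => v y 0 i) (fun i => w y 0 i) (fun i => om y 0 i)
  (fun i j => partial i (fun z => om z 0 j) y)
  (fun i j => partial i (fun z => w z 0 j) y)).
rewrite (sum_directional (fun i => w y 0 i) (fun i => v y 0 i) (fun i => om y 0 i)
  (fun i j => partial i (fun z => om z 0 j) y)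
  (fun i j => partial i (fun z => v z 0 j) y)).
have cancel (a b c d : R) : a + b - (c + d) - (b - d) = a - c by ring.
rewrite cancel /ext_deriv -sumrB; apply: eq_bigr => i _; rewrite -sumrB.
by apply: eq_bigr => j _; ring.
Qed.

Lemma partial_comm g i j y : smooth_fun_at y g ->
  partial i (partial j g) y = partial j (partial i g) y.
Proof.
move=> sg; apply: derive_comm.
- apply: filterS (smooth_near sg) => z sz.
  by split; apply: smooth_diff => //; exact: smooth_partial.
- by apply/differentiable_continuous/smooth_diff/smooth_partial/smooth_partial.
- by apply/differentiable_continuous/smooth_diff/smooth_partial/smooth_partial.
Qed.

Lemma ext_deriv_exact g y a b : smooth_fun_at y g ->
  ext_deriv (fun z => \row_j partial j g z) y a b = 0.
Proof.
move=> sg; transitivity (\sum_i \sum_j partial i (partial j g) y * (a 0 i * b 0 j)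
   - \sum_i \sum_j partial i (partial j g) y * (a 0 j * b 0 i)).
  rewrite -sumrB; apply: eq_bigr => i _; rewrite -sumrB; apply: eq_bigr => j _.
  by rewrite mulrBr; under eq_fun do rewrite mxE.
rewrite [X in _ - X]exchange_big/=; apply/eqP; rewrite subr_eq0; apply/eqP.
by apply: eq_bigr => i _; apply: eq_bigr => j _; rewrite partial_comm.
Qed.

(** Cartan's formula for the closed form dg, whose contraction with a field is the directional
    derivative of g. *)
Lemma directional_lie_bracket v w g y :
  smooth_at y v -> smooth_at y w -> smooth_fun_at y g ->
  directional (lie_bracket v w) g y =
  directional v (directional w g) y - directional w (directional v g) y.
Proof.
move=> sv sw sg.
have sdg : smooth_at y (fun z => \row_j partial j g z).
  by apply/smooth_atP => i j; under eq_fun do rewrite mxE; exact: smooth_partial.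
have dirE u : directional u g =
    fun z => contract (\row_j partial j g z) (u z).
  by apply/funext => z; apply: eq_bigr => j _; rewrite mxE mulrC.
apply/esym/eqP; rewrite -subr_eq0 !dirE -ext_deriv_lie_bracket//.
by rewrite ext_deriv_exact.
Qed.

End LieCalculus.

(** Chain rule. Only the push-forward of v at the point y enters, so it is given as a vector [a] and
    not as a field on the target. *)
Lemma directional_comp (R : realType) N M (v : 'rV[R]_N -> 'rV[R]_N)
    (f : 'rV[R]_N -> 'rV[R]_M) (a : 'rV[R]_M) (h : 'rV[R]_M -> R) y :
  smooth_at y f -> smooth_fun_at (f y) h ->
  (forall r, directional v (fun z => f z 0 r) y = a 0 r) ->
  directional v (fun z => h (f z)) y = directional (fun=> a) h (f y).
Proof.
move=> /smooth_atP sf sh va; rewrite /directional.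
transitivity (\sum_i \sum_r v y 0 i * (partial r h (f y) *
    partial i (fun z => f z 0 r) y)).
  apply: eq_bigr => i _; rewrite -mulr_sumr; congr (_ * _).
  by apply: (partial_comp _ _ _).2 => [r|]; exact: smooth_diff.
rewrite exchange_big/=; apply: eq_bigr => r _; rewrite -va mulr_suml.
by apply: eq_bigr => i _; ring.
Qed.

(** * Smooth linear algebra *)

Section RightInverse.
Variables (R : realType).

Lemma mulmx_tr_eq0 b (u : 'rV[R]_b) : u *m u^T = 0 -> u = 0.
Proof.
move=> /matrixP/(_ 0 0); rewrite !mxE => /eqP.
rewrite psumr_eq0 => [|j _]; last by rewrite mxE -expr2 sqr_ge0.
move=> /allP u0; apply/rowP => j; rewrite mxE.
have /implyP := u0 j (mem_index_enum j).
by rewrite mxE -expr2 sqrf_eq0 => /(_ isT)/eqP.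
Qed.

(** If v M M^T = 0 then v M is orthogonal to itself, hence zero over the reals. *)
Lemma gram_unitmx a b (M : 'M[R]_(a, b)) : row_free M -> M *m M^T \in unitmx.
Proof.
move=> freeM; rewrite -row_free_unit; apply: inj_row_free => v vMM.
apply/eqP; rewrite -(mulmx_free_eq0 v freeM); apply/eqP/mulmx_tr_eq0.
by rewrite trmx_mul -mulmxA (mulmxA M) mulmxA vMM mul0mx.
Qed.

(** A right inverse given by a closed formula, hence smooth in M as long as the rows stay
    independent. *)
Definition rinvmx a b (M : 'M[R]_(a, b)) : 'M[R]_(b, a) :=
  M^T *m invmx (M *m M^T).

Lemma mulmx_rinvmx a b (M : 'M[R]_(a, b)) :
  row_free M -> M *m rinvmx M = 1%:M.
Proof. by move=> freeM; rewrite mulmxA mulmxV// gram_unitmx. Qed.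

(** [A *m rinvmx M] holds the coordinates of the rows of A in the basis formed by the rows of M. *)
Lemma submx_rinvmx a b c (A : 'M[R]_(c, b)) (M : 'M[R]_(a, b)) :
  row_free M -> (A <= M)%MS -> A *m rinvmx M *m M = A.
Proof.
move=> freeM /submxP[D ->].
by rewrite -(mulmxA D) mulmx_rinvmx// mulmx1.
Qed.

End RightInverse.

Section SmoothLinearSystems.
Variables (R : realType) (N : nat) (p : 'rV[R]_N).

Lemma smooth_rinvmx a b (M : 'rV[R]_N -> 'M[R]_(a, b)) :
  smooth_at p M -> row_free (M p) -> smooth_at p (fun z => rinvmx (M z)).
Proof.
move=> sM freeM; have sMT := smooth_at_tr sM; apply: smooth_atM => //.
by apply: smooth_at_invmx; [exact: smooth_atM|exact: gram_unitmx].
Qed.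

Lemma near_row_free a b (M : 'rV[R]_N -> 'M[R]_(a, b)) :
  smooth_at p M -> row_free (M p) -> \forall y \near p, row_free (M y).
Proof.
move=> sM freeM.
have sG : smooth_at p (fun z => M z *m (M z)^T).
  by apply: smooth_atM => //; exact: smooth_at_tr.
apply: filterS (near_unitmx sG (gram_unitmx freeM)) => y uG.
by apply/row_freeP; exists (rinvmx (M y)); rewrite mulmxA mulmxV.
Qed.

(** Rows of M that form a basis of its row space at p still do so nearby, because the rank is
    constant. The selected equations are solved by [rinvmx]; the other ones follow from them, as the
    relations between the rows of M can be chosen smooth and hold for c by the compatibility
    hypothesis. *)
Lemma smooth_solve a b (M : 'rV[R]_N -> 'M[R]_(a, b)) (c : 'rV[R]_N -> 'cV[R]_a) :
  smooth_at p M -> smooth_at p c ->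
  (\forall y \near p, \rank (M y) = \rank (M p)) ->
  (forall k : 'rV[R]_N -> 'rV[R]_a, smooth_at p k ->
     (\forall y \near p, k y *m M y = 0) -> \forall y \near p, k y *m c y = 0) ->
  exists2 x : 'rV[R]_N -> 'cV[R]_b, smooth_at p x &
    \forall y \near p, M y *m x y = c y.
Proof.
move=> sM sc rkM compat.
(* The selection of rows is made once, at p, to keep [S] smooth. *)
pose sel := maxrankfun (M p); pose S z := rowsub sel (M z).
have sS : smooth_at p S by exact: smooth_at_mxsub.
have freeSp : row_free (S p) by exact: maxrowsub_free.
have sI := smooth_rinvmx sS freeSp.
pose C z := M z *m rinvmx (S z).
have sC : smooth_at p C by exact: smooth_atM.
have nMC : \forall y \near p, M y = C y *m S y.
  apply: filterS2 (near_row_free sS freeSp) rkM => y freeS rkMy.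
  rewrite submx_rinvmx//.
  have SM : (S y <= M y)%MS by exact: rowsub_sub.
  by rewrite -(geq_leqif (mxrank_leqif_sup SM)) rkMy (eqP freeS).
(* The rows of [K] are the relations that express each row of M by the selected ones; applied to c,
   they say that c is determined by its selected entries. *)
pose K z := 1%:M - C z *m rowsub sel 1%:M.
have KE z : K z *m M z = M z - C z *m S z.
  by rewrite mulmxBl mul1mx -mulmxA -rowsubE.
have sK : smooth_at p K.
  apply: smooth_atD; first exact: smooth_at_cst.
  by apply: smooth_atN; apply: smooth_atM => //; exact: smooth_at_cst.
have nKc : \forall y \near p, K y *m c y = 0.
  have : \forall y \near p, forall i, row i (K y) *m c y = 0.
    apply: near_forall => i; apply: compat; first exact: smooth_at_row.
    by apply: filterS nMC => y MC; rewrite -row_mul KE {1}MC subrr row0.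
  apply: filterS => y Kc; apply/row_matrixP => i.
  by rewrite row_mul Kc row0.
exists (fun z => rinvmx (S z) *m rowsub sel (c z)).
  by apply: smooth_atM => //; exact: smooth_at_mxsub.
apply: filterS nKc => y; rewrite mulmxBl mul1mx -mulmxA -rowsubE.
by move/eqP; rewrite subr_eq0 mulmxA => /eqP <-.
Qed.

End SmoothLinearSystems.

(** * Spans and local bases *)

Section Bases.
Variables (R : realType) (N : nat) (p : 'rV[R]_N).

Lemma span_at_smooth d (W : 'rV[R]_N -> 'M[R]_(d, N)) w :
  smooth_at p W -> span_at p W w -> smooth_at p w.
Proof.
move=> sW [c sc wE].
apply: (@smooth_at_near_eq _ _ _ _ _ (fun z => c z *m W z)).
  by apply: filterS wE => y ->.
exact: smooth_atM.
Qed.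

Lemma span_at_row d (W : 'rV[R]_N -> 'M[R]_(d, N)) i :
  span_at p W (fun z => row i (W z)).
Proof.
exists (fun=> delta_mx 0 i); first exact: smooth_at_cst.
by apply: near_all => y; rewrite rowE.
Qed.

Lemma span_at_submx d e (V : 'rV[R]_N -> 'M[R]_(d, N))
    (W : 'rV[R]_N -> 'M[R]_(e, N)) :
  (forall i, span_at p W (fun z => row i (V z))) ->
  \forall y \near p, (V y <= W y)%MS.
Proof.
move=> VW; have : \forall y \near p, forall i, (row i (V y) <= W y)%MS.
  apply: near_forall => i; have [c _ cE] := VW i.
  by apply: filterS cE => y ->; exact: submxMl.
by apply: filterS => y VWy; apply/row_subP.
Qed.

Lemma local_basis_eqmx d e (V : 'rV[R]_N -> 'M[R]_(d, N))
    (W : 'rV[R]_N -> 'M[R]_(e, N)) P :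
  local_basis p V P -> local_basis p W P -> \forall y \near p, (V y :=: W y)%MS.
Proof.
move=> [_ _ PV] [_ _ PW].
have VW : \forall y \near p, (V y <= W y)%MS.
  by apply: span_at_submx => i; rewrite -PW PV; exact: span_at_row.
have WV : \forall y \near p, (W y <= V y)%MS.
  by apply: span_at_submx => i; rewrite -PV PW; exact: span_at_row.
by apply: filterS2 VW WV => y ? ?; apply/eqmxP/andP.
Qed.

Lemma span_at_sub d e (V : 'rV[R]_N -> 'M[R]_(d, N))
    (W : 'rV[R]_N -> 'M[R]_(e, N)) (C : 'rV[R]_N -> 'M[R]_(d, e)) :
  smooth_at p C -> (\forall y \near p, V y = C y *m W y) ->
  span_at p V `<=` span_at p W.
Proof.
move=> sC VE w [c sc wE]; exists (fun z => c z *m C z); first exact: smooth_atM.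
by apply: filterS2 wE VE => y -> ->; rewrite mulmxA.
Qed.

End Bases.

(** * Decomposable forms and integrability *)

Section Wedge.
Variables (R : realType) (N d : nat).

(* Exchanging a with the slot of row k preserves the products and flips the
   sign of the permutation. *)
Lemma wedge2_decomposable_eq0 (W : 'M[R]_(d, N)) (X : 'I_(2 + d) -> 'rV[R]_N)
    (g : 'rV[R]_N -> R) (a b : 'I_(2 + d)) (k : 'I_d) :
  a != b -> (forall j, rshift 2 j != a) -> (forall j, rshift 2 j != b) ->
  \sum_(s : 'S_(2 + d)) (-1) ^+ s *
    (contract (X (s a)) (row k W) * g (X (s b))) *
    \prod_(j < d) contract (X (s (rshift 2 j))) (row j W) = 0.
Proof.
move=> ab ka kb; set S := (X in X = 0).
suff : S = - S by move/eqP; rewrite -addr_eq0 -mulr2n mulrn_eq0/= => /eqP.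
pose t := tperm a (rshift 2 k).
rewrite {1}/S (reindex_inj (mulgI t)) -sumrN; apply: eq_bigr => s _.
rewrite odd_permM odd_tperm eq_sym ka signr_addb/= expr1 !mulNr mul1r.
congr (- _); rewrite -!mulrA; congr (_ * _).
rewrite (bigD1 k)//= [in RHS](bigD1 k)//= !permM /t tpermL tpermR.
rewrite tpermD//.
rewrite (eq_bigr (fun i => contract (X (s (rshift 2 i))) (row i W))).
  ring.
move=> i ik; rewrite permM tpermD// ?(eq_sym a)//.
by rewrite (inj_eq (@rshift_inj _ _)) eq_sym.
Qed.

(** A bilinear form vanishing on pairs of vectors of ker W is a sum of products with one factor a
    row of W. Wedged with all rows of W, each summand contains the same row twice. *)
Lemma wedge2_eq0 (K : 'M[R]_N) (W : 'M[R]_(d, N)) :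
  row_free W ->
  (forall a b : 'rV[R]_N, W *m a^T = 0 -> W *m b^T = 0 -> a *m K *m b^T = 0) ->
  forall X, wedge2 (fun a b => (a *m K *m b^T) 0 0) W X = 0.
Proof.
move=> freeW Kker X; set beta := fun a b => _.
pose G := rinvmx W.
pose proj (a : 'rV[R]_N) := a *m W^T *m G^T.
have projE a : proj a = \sum_k contract a (row k W) *: row k G^T.
  rewrite /proj mulmx_sum_row; apply: eq_bigr => k _; congr (_ *: _).
  by rewrite contractE mxE [in RHS]mxE; apply: eq_bigr => j _; rewrite !mxE.
have ker_proj a : W *m (a - proj a)^T = 0.
  rewrite linearB/= mulmxBr /proj !trmx_mul !trmxK (mulmxA W G).
  by rewrite mulmx_rinvmx// mul1mx subrr.
(* Splitting a and b along [proj] leaves three terms besides the one on kernel vectors; a - [proj a]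
   is in the kernel, and the rows of G^T are dual to those of W. *)
have betaE a b : beta a b =
    \sum_k contract a (row k W) * beta (row k G^T) b +
    \sum_k contract b (row k W) * beta (a - proj a) (row k G^T).
  have -> : \sum_k contract a (row k W) * beta (row k G^T) b = beta (proj a) b.
    rewrite projE /beta !mulmx_suml summxE; apply: eq_bigr => k _.
    by rewrite -!scalemxAl [RHS]mxE.
  have -> : \sum_k contract b (row k W) * beta (a - proj a) (row k G^T) =
      beta (a - proj a) (proj b).
    rewrite (projE b) /beta linear_sum/= mulmx_sumr summxE.
    by apply: eq_bigr => k _; rewrite linearZ/= -scalemxAr [RHS]mxE.
  have := Kker _ _ (ker_proj a) (ker_proj b).
  rewrite [in X in X -> _]linearB/= mulmxBr => /eqP; rewrite subr_eq0 => /eqP E.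
  by rewrite /beta -E -[in LHS](subrK (proj a) a) !mulmxDl [LHS]mxE addrC.
rewrite /wedge2; apply/eqP; rewrite mulf_eq0; apply/orP; right; apply/eqP.
set a0 := lshift d ord0; set a1 := lshift d ord_max.
have a01 : a0 != a1 by rewrite (inj_eq (@lshift_inj _ _)).
have ka0 (j : 'I_d) : rshift 2 j != a0 by rewrite eq_rlshift.
have ka1 (j : 'I_d) : rshift 2 j != a1 by rewrite eq_rlshift.
transitivity (\sum_k (\sum_(s : 'S_(2 + d)) (-1) ^+ s *
    (contract (X (s a0)) (row k W) * beta (row k G^T) (X (s a1))) *
    \prod_(j < d) contract (X (s (rshift 2 j))) (row j W)) +
  \sum_k (\sum_(s : 'S_(2 + d)) (-1) ^+ s *
    (contract (X (s a1)) (row k W) *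
      beta (X (s a0) - proj (X (s a0))) (row k G^T)) *
    \prod_(j < d) contract (X (s (rshift 2 j))) (row j W))).
  rewrite [X in _ = X + _]exchange_big [X in _ = _ + X]exchange_big/=.
  rewrite -big_split/=.
  apply: eq_bigr => s _; rewrite betaE mulrDr mulrDl !mulr_sumr !mulr_suml.
  by congr (_ + _); apply: eq_bigr => k _.
rewrite !big1 ?addr0// => k _.
  by apply: (wedge2_decomposable_eq0 W X (fun x => beta (x - proj x) (row k G^T)));
    rewrite // eq_sym.
exact: (wedge2_decomposable_eq0 W X (beta (row k G^T))).
Qed.

Lemma ext_derivE (w : 'rV[R]_N -> 'rV[R]_N) y a b :
  let J := \matrix_(i, j) partial i (fun z => w z 0 j) y in
  ext_deriv w y a b = (a *m (J - J^T) *m b^T) 0 0.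
Proof.
move=> J; rewrite mulmxBr mulmxBl !mxE.
rewrite (_ : \sum_j (a *m J) 0 j * b^T j 0 =
  \sum_i \sum_j partial i (fun z => w z 0 j) y * (a 0 i * b 0 j)); last first.
  rewrite exchange_big/=; apply: eq_bigr => j _; rewrite !mxE mulr_suml.
  by apply: eq_bigr => i _; rewrite !mxE; ring.
rewrite (_ : \sum_j (a *m J^T) 0 j * b^T j 0 =
  \sum_i \sum_j partial i (fun z => w z 0 j) y * (a 0 j * b 0 i)); last first.
  apply: eq_bigr => i _; rewrite !mxE mulr_suml.
  by apply: eq_bigr => j _; rewrite !mxE; ring.
rewrite -sumrB; apply: eq_bigr => i _; rewrite -sumrB.
by apply: eq_bigr => j _; rewrite mulrBr.
Qed.

End Wedge.

(** * Submersions are open *)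

Section Submersion.
Variables (R : realType).

Lemma ler_entry_norm n (u : 'rV[R]_n) j : `|u 0 j| <= `|u|.
Proof.
by rewrite [leRHS]/Num.Def.normr/= mx_normrE; exact: (le_bigmax _ _ (ord0, j)).
Qed.

(** The norm on rows is the maximum norm, while the function to be minimized must be differentiable,
    hence this comparison with the Euclidean square and the next one, which costs a factor n. *)
Lemma sqr_norm_le_contract n (u : 'rV[R]_n) : `|u| ^+ 2 <= contract u u.
Proof.
have [->|u0] := eqVneq u 0.
  by rewrite normr0 expr0n/=; apply: sumr_ge0 => j _; rewrite mxE mul0r.
have : mx_norm u != 0 by apply: contraNneq u0 => /mx_norm_eq0 ->.
move=> /mx_norm_neq0[[i j] /= uE].
rewrite [`|u|]uE ord1 real_normK ?num_real// /contract (bigD1 j)//= -expr2.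
by rewrite lerDl; apply: sumr_ge0 => k _; rewrite -expr2 sqr_ge0.
Qed.

Lemma contract_le_sqr_norm n (u : 'rV[R]_n) : contract u u <= n%:R * `|u| ^+ 2.
Proof.
rewrite mulr_natl -[X in _ *+ X]card_ord -sumr_const; apply: ler_sum => j _.
by rewrite -expr2 -[u 0 j ^+ 2]real_normK ?num_real//
  lerXn2r ?nnegrE ?ler_entry_norm.
Qed.

Lemma smooth_at_id n (p : 'rV[R]_n) : smooth_at p id.
Proof. by apply/smooth_atP => i j; rewrite ord1; exact: smooth_coord. Qed.

Lemma differentials_affine n N (f : 'rV[R]_N -> 'rV[R]_n) (p : 'rV[R]_N)
    (B : 'M[R]_(n, N)) : smooth_at p f ->
  differentials (fun z : 'rV[R]_n => f (p + z *m B)) 0 =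
  differentials f p *m B^T.
Proof.
move=> sf; apply/matrixP => i j; rewrite !mxE.
have coordE (r : 'I_N) : (fun z : 'rV[R]_n => (p + z *m B) 0 r) =
    fun z => p 0 r + \sum_k z 0 k * B k r.
  by apply/funext => z; rewrite !mxE.
have dsum (r : 'I_N) := @partial_sum R n _ (fun k z => z 0 k * B k r) j 0 (fun k =>
  smooth_diff (smoothM (smooth_coord 0 k) (smooth_cst 0 (B k r)))).
have [| |_ ->] := @partial_comp R n N (fun z => p + z *m B) (fun z => f z 0 i) j 0.
- move=> r; rewrite coordE; apply: (@differentiableD _ _ _ (cst (p 0 r))).
    exact: differentiable_cst.
  by have [] := dsum r.
- by rewrite mul0mx addr0; apply: smooth_diff; move/smooth_atP : sf; exact.
apply: eq_bigr => r _; rewrite mul0mx addr0 !mxE; congr (_ * _).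
have [dr drE] := dsum r.
rewrite coordE partialD; [|exact: differentiable_cst|exact: dr].
rewrite partial_cst add0r drE (bigD1 j)//= big1 ?addr0 => [|k kj].
  rewrite partialM; [|exact: differentiable_coord|exact: differentiable_cst].
  by rewrite partial_coord partial_cst eqxx mul1r mulr0 addr0.
rewrite partialM; [|exact: differentiable_coord|exact: differentiable_cst].
by rewrite partial_coord partial_cst (negbTE kj) mul0r mulr0 addr0.
Qed.

Lemma diff_differentials n N (f : 'rV[R]_N -> 'rV[R]_n) (p h : 'rV[R]_N) :
  smooth_at p f -> 'd f p h = h *m (differentials f p)^T.
Proof.
move=> /smooth_atP sf.
have dfi i : differentiable (fun z => f z 0 i) p by exact: smooth_diff.
have df : differentiable f p by exact: differentiable_row.
rewrite -deriveE// derive_mx; last exact: diff_derivable.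
apply/rowP => i; rewrite !mxE deriveE// diffE_partial//.
by apply: eq_bigr => r _; rewrite !mxE mulrC.
Qed.

(* The minimum of |F - x|^2 over a small closed ball is attained in its
   interior, where criticality forces F = x as the Jacobian is invertible. *)
Lemma near_local_surjection n (F : 'rV[R]_n -> 'rV[R]_n) (P : set 'rV[R]_n) :
  smooth_at 0 F -> differentials F 0 = 1%:M ->
  (\forall z \near (0 : 'rV[R]_n), P z) ->
  \forall x \near F 0, exists2 z, P z & F z = x.
Proof.
move=> sF dF nP.
(* First-order expansion of F at 0, where its Jacobian is the identity. *)
have nbound : \forall z \near (0 : 'rV[R]_n), `|F z - F 0 - z| <= 2^-1 * `|z|.
  have /smooth_atP sF' := sF.
  have dF0 : differentiable F 0.
    by apply: differentiable_row => i; exact: smooth_diff.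
  have /diff_locally/eqaddoP/(_ 2^-1) := dF0.
  rewrite invr_gt0 ltr0n => /(_ isT); apply: filterS => z.
  rewrite !fctE/= addr0 diff_differentials// dF trmx1 mulmx1.
  by rewrite opprD addrA.
have nsmooth : \forall z \near (0 : 'rV[R]_n), smooth_at z F.
  exact: near_near.
have nunit : \forall z \near (0 : 'rV[R]_n), differentials F z \in unitmx.
  apply: near_unitmx; first exact: smooth_differentials.
  by rewrite dF unitmx1.
have /nbhs_ballP[e /= e0 eP] : \forall z \near (0 : 'rV[R]_n),
    [/\ P z, `|F z - F 0 - z| <= 2^-1 * `|z|, smooth_at z F &
        differentials F z \in unitmx].
  by near=> z; split; near: z.
pose r := e / 2; have r0 : 0 < r by rewrite divr_gt0.
have inball z : `|z| <= r -> [/\ P z, `|F z - F 0 - z| <= 2^-1 * `|z|,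
    smooth_at z F & differentials F z \in unitmx].
  move=> zr; apply: eP; rewrite -ball_normE/= sub0r normrN.
  by rewrite (le_lt_trans zr)// /r ltr_pdivrMr// mulr_natr mulr2n ltrDl.
(* On the sphere of radius r, F z is at distance at least r / 2 = (n+2) delta from F 0, hence at
   least (n+1) delta from x. So [g] is at least ((n+1) delta)^2 there, more than its bound n delta^2
   at the centre, and the minimum is interior. *)
pose delta := r / 2 / (n.+2)%:R.
have delta0 : 0 < delta by rewrite !divr_gt0.
apply/nbhs_ballP; exists delta => //= x; rewrite -ball_normE/= => xdelta.
pose g z := contract (F z - x) (F z - x).
pose K := [set z : 'rV[R]_n | `|z| <= r].
have sg z : `|z| <= r -> smooth_fun_at z g.
  move=> /inball[_ _ sFz _].
  by apply: smooth_contract; apply: smooth_atD => //; exact: smooth_at_cst.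
have cK : compact K.
  apply: bounded_closed_compact.
    exists r; split; first exact: num_real.
    by move=> M rM z /= zr; rewrite (le_trans zr)// ltW.
  rewrite (_ : K = (fun z : 'rV[R]_n => `|z|) @^-1` [set t : R | t <= r])//.
  by apply: closed_comp; [move=> z _; exact: norm_continuous|exact: closed_le].
have [z zK zmin] : exists2 z, z \in K & forall t, t \in K -> g z <= g t.
  apply: EVT_min_rV => //; first by exists 0; rewrite /K/= normr0 ltW.
  apply: continuous_in_subspaceT => z /set_mem zK.
  exact/differentiable_continuous/smooth_diff/sg.
have zr : `|z| <= r by move/set_mem : zK.
have g0 : g 0 <= n%:R * delta ^+ 2.
  rewrite (le_trans (contract_le_sqr_norm _))// ler_wpM2l// lerXn2r ?nnegrE//.
    by rewrite ltW.
  by rewrite ltW.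
have zltr : `|z| < r.
  rewrite lt_neqAle zr andbT; apply/eqP => zE.
  have [_ Fz _ _] := inball _ zr.
  have lb : n.+1%:R * delta <= `|F z - x|.
    have t1 : `|z| <= `|F z - F 0 - z| + (`|F z - x| + `|F 0 - x|).
      have zdec : z = - (F z - F 0 - z) + ((F z - x) - (F 0 - x)).
        by apply/rowP => j; rewrite !mxE; ring.
      rewrite {1}zdec; apply: (le_trans (ler_normD _ _)).
      apply: lerD; last exact: ler_normB.
      by rewrite normrN.
    have rE : r = 2 * (delta + n.+1%:R * delta).
      have -> : delta + n.+1%:R * delta = (n.+2)%:R * delta.
        by rewrite -[n.+2]add1n natrD mulrDl mul1r.
      rewrite /delta [n.+2%:R * _]mulrC divfK ?pnatr_eq0//.
      by rewrite mulrC divfK ?pnatr_eq0.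
    move: t1 Fz xdelta; rewrite zE rE.
    move: (`|F z - x|) (`|F 0 - x|) (`|_ - _ - _|) (n.+1%:R * delta) => A B C D.
    move=> *; lra.
  have := zmin 0; rewrite inE /K/= normr0 ltW// => /(_ isT) zmin0.
  have := le_trans (sqr_norm_le_contract (F z - x)) (le_trans zmin0 g0).
  apply/negP; rewrite -ltNge.
  have : (n.+1%:R * delta) ^+ 2 <= `|F z - x| ^+ 2.
    by rewrite lerXn2r ?nnegrE// mulr_ge0// ltW.
  move=> lb2; apply: (lt_le_trans _ lb2); rewrite [ltRHS]exprMn.
  rewrite ltr_pM2r ?exprn_gt0// -natrX ltr_nat.
  by rewrite -mulnn mulSn addSn ltnS leq_addr.
(* Interior minimum on each coordinate line through z; [rho] is the distance left to the sphere. *)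
have crit j : partial j g z = 0.
  pose rho := r - `|z|; have rho0 : 0 < rho by rewrite subr_gt0.
  have delta1 : `|delta_mx 0 j : 'rV[R]_n| <= 1.
    rewrite [leLHS]/Num.Def.normr/= mx_normrE; apply: bigmax_le => // -[i k] _ /=.
    by rewrite mxE; case: (_ && _); rewrite ?normr1 ?normr0.
  have inK (t : R) : t \in `]- rho, rho[ -> `|z + t *: delta_mx 0 j| <= r.
    rewrite in_itv/= -ltr_norml => trho; rewrite (le_trans (ler_normD _ _))//.
    rewrite -lerBrDl normrZ (le_trans _ (ltW trho))//.
    by rewrite ler_piMr.
  have dline (t : R) : t \in `]- rho, rho[ ->
      is_derive t 1 (fun s : R => g (z + s *: delta_mx 0 j))
        ('D_(delta_mx 0 j) g (z + t *: delta_mx 0 j)).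
    by move=> /inK tK; apply: is_derive_line; exact/smooth_diff/sg.
  have zero_in : (0 : R) \in `]- rho, rho[ by rewrite in_itv/= oppr_lt0 rho0.
  have := @derive1_at_min R (fun s : R => g (z + s *: delta_mx 0 j)) (- rho) rho 0.
  move=> /(_ _ _ zero_in _)[].
  - by rewrite (le_trans (ltW (_ : - rho < 0)))// ?oppr_lt0// ltW.
  - by move=> t /dline[].
  - move=> t /inK tK; rewrite scale0r addr0; apply: zmin.
    by rewrite inE.
  - move=> _; have [_] := dline _ zero_in.
    by rewrite scale0r addr0 /partial => ->.
have [Pz _ sFz uz] := inball _ zr; exists z => //.
apply/eqP; rewrite -subr_eq0; apply/eqP.
(* Up to the factor 2, this row is the gradient of [g] at z. *)
have gradE : (F z - x) *m differentials F z = 0.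
  apply/rowP => j; rewrite !mxE; apply: (mulfI (lt0r_neq0 (ltr0Sn R 1))).
  rewrite mulr0 -[RHS](crit j) /g /contract.
  have sFx : smooth_at z (fun t => F t - x).
    by apply: smooth_atD => //; exact: smooth_at_cst.
  have dFx i : differentiable (fun t => (F t - x) 0 i) z.
    by move/smooth_atP : sFx => sFx; exact: smooth_diff.
  have dFi i : differentiable (fun t => F t 0 i) z.
    by move/smooth_atP : sFz => sFz'; exact: smooth_diff.
  have [|_ ->] := @partial_sum R n _ (fun i t => (F t - x) 0 i * (F t - x) 0 i) j z.
    by move=> i; exact: differentiableM.
  rewrite mulr_sumr; apply: eq_bigr => i _; rewrite partialM//.
  have -> : partial j (fun t => (F t - x) 0 i) z = partial j (fun t => F t 0 i) z.
    under eq_fun do rewrite !mxE.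
    rewrite partialD; [|exact: dFi|exact: differentiable_cst].
    by rewrite partial_cst addr0.
  by rewrite [differentials _ _ _ _]mxE; ring.
by rewrite -(mulmxK uz (F z - x)) gradE mul0mx.
Unshelve. all: by end_near. Qed.

(** Restricted to the affine slice through p directed by a right inverse of the Jacobian, f becomes
    a map between spaces of equal dimension with identity Jacobian at 0. *)
Lemma near_image n N (f : 'rV[R]_N -> 'rV[R]_n) (p : 'rV[R]_N)
    (P : set 'rV[R]_n) :
  smooth_at p f -> row_free (differentials f p) ->
  (\forall y \near p, P (f y)) -> \forall x \near f p, P x.
Proof.
move=> sf freef nP; pose B := (rinvmx (differentials f p))^T.
pose lift (z : 'rV[R]_n) := p + z *m B.
have lift0 : lift 0 = p by rewrite /lift mul0mx addr0.
have slift : smooth_at 0 lift.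
  apply: smooth_atD; first exact: smooth_at_cst.
  by apply: smooth_atM; [exact: smooth_at_id|exact: smooth_at_cst].
have nPlift : \forall z \near (0 : 'rV[R]_n), P (f (lift z)).
  have clift : {for 0, continuous lift} := smooth_at_continuous slift.
  have nP0 : \forall y \near lift 0, P (f y) by rewrite lift0.
  exact: clift nP0.
have sF : smooth_at 0 (fun z => f (lift z)).
  by apply: smooth_at_comp; rewrite ?lift0.
have dF : differentials (fun z => f (lift z)) 0 = 1%:M.
  by rewrite differentials_affine// trmxK mulmx_rinvmx.
have := near_local_surjection sF dF nPlift.
by rewrite lift0; apply: filterS => x [z Pz <-].
Qed.

End Submersion.

(** * Frobenius condition on vectors of the kernel *)

Section Pfaffian.
Variables (R : realType) (N : nat) (p : 'rV[R]_N).
Implicit Types (P : set ('rV[R]_N -> 'rV[R]_N)).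

(** It quantifies over vectors at y rather than over fields, because d(omega) is tensorial. For
    independent rows it yields the wedge condition through [wedge2_eq0]. *)
Definition pfaffian_at d (W : 'rV[R]_N -> 'M[R]_(d, N)) :=
  \forall y \near p, forall i (X Y : 'rV[R]_N),
    W y *m X^T = 0 -> W y *m Y^T = 0 ->
    ext_deriv (fun z => row i (W z)) y X Y = 0.

Lemma row_contract d (W : 'M[R]_(d, N)) i v :
  contract (row i W) v = (W *m v^T) i 0.
Proof. by rewrite contractE -row_mul mxE. Qed.

Lemma pfaffian_integrable d (W : 'rV[R]_N -> 'M[R]_(d, N)) P :
  local_basis p W P -> pfaffian_at W -> integrable_codist p P.
Proof.
move=> bW pW; exists d, W; split=> // i; case: bW => _ freeW _.
apply: filterS2 freeW pW => y freeWy pWy X.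
pose J := \matrix_(k, j) partial k (fun z => row i (W z) 0 j) y.
have -> : ext_deriv (fun z => row i (W z)) y =
    fun a b => (a *m (J - J^T) *m b^T) 0 0.
  by apply/funext => a; apply/funext => b; exact: ext_derivE.
apply: wedge2_eq0 => // a b Wa Wb; apply/matrixP => r s.
by rewrite !ord1 -ext_derivE mxE; exact: pWy.
Qed.

(** For fields v and w killed by W near p, Cartan's formula reduces to om([v, w]) = - d om(v, w). *)
Lemma pfaffian_lie_bracket d (W : 'rV[R]_N -> 'M[R]_(d, N)) v w :
  smooth_at p W -> pfaffian_at W -> smooth_at p v -> smooth_at p w ->
  (\forall y \near p, W y *m (v y)^T = 0) ->
  (\forall y \near p, W y *m (w y)^T = 0) ->
  \forall y \near p, W y *m (lie_bracket v w y)^T = 0.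
Proof.
move=> sW pW sv sw Wv Ww.
have kill0 u : (\forall y \near p, W y *m (u y)^T = 0) ->
    \forall y \near p, forall i, \forall z \near y,
      contract (row i (W z)) (u z) = 0.
  move=> Wu; apply: near_forall => i; apply: near_near.
  by apply: filterS Wu => y Wu; rewrite row_contract Wu mxE.
have sW' : \forall y \near p, smooth_at y W by exact: near_near.
have sv' : \forall y \near p, smooth_at y v by exact: near_near.
have sw' : \forall y \near p, smooth_at y w by exact: near_near.
have kv := kill0 _ Wv; have kw := kill0 _ Ww.
near=> y.
have sWy : smooth_at y W by near: y.
have svy : smooth_at y v by near: y.
have swy : smooth_at y w by near: y.
apply/matrixP => i j; rewrite ord1 -row_contract mxE.
have := @ext_deriv_lie_bracket R N v (fun z => row i (W z)) w y svy
  (smooth_at_row i sWy) swy.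
rewrite directional_near0; last by move: i; near: y.
rewrite directional_near0; last by move: i; near: y.
have -> : ext_deriv (fun z => row i (W z)) y (v y) (w y) = 0.
  by apply: (near pW y); [|near: y|near: y].
by rewrite subr0 sub0r => /eqP; rewrite eq_sym oppr_eq0 => /eqP.
Unshelve. all: by end_near. Qed.

(* Constant vector fields commute. *)
Lemma ext_deriv_cst om y (a b : 'rV[R]_N) : smooth_at y om ->
  ext_deriv om y a b =
  directional (fun=> a) (fun z => contract (om z) b) y -
  directional (fun=> b) (fun z => contract (om z) a) y.
Proof.
move=> so; rewrite (@ext_deriv_lie_bracket _ _ (fun=> a) om (fun=> b))//;
  [|exact: smooth_at_cst..].
rewrite (_ : lie_bracket _ _ y = 0) ?contractE ?trmx0 ?mulmx0 ?mxE ?subr0//.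
apply/rowP => i; rewrite !mxE /directional !big1 ?subr0// => j _.
  by rewrite partial_cst mulr0.
by rewrite partial_cst mulr0.
Qed.

End Pfaffian.

(** * Codistributions spanned by 1-forms in the state variables *)

Lemma smooth_lsubmx (R : realType) n m (p : 'rV[R]_(n + m)) :
  smooth_at p (fun y => lsubmx y).
Proof.
apply/smooth_atP => i j; under eq_fun do rewrite mxE.
by rewrite ord1; exact: smooth_coord.
Qed.

Lemma near_comp (R : realType) N M (p : 'rV[R]_N) (f : 'rV[R]_N -> 'rV[R]_M)
    (P : set 'rV[R]_M) :
  smooth_at p f -> (\forall x \near f p, P x) -> \forall y \near p, P (f y).
Proof. by move=> sf nP; exact: (smooth_at_continuous sf) nP. Qed.

Section StateCodistributions.
Variables (R : realType) (n m : nat).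
Implicit Types (y : 'rV[R]_(n + m)).

Lemma dxE y : dx y = row_mx 1%:M 0.
Proof.
apply/matrixP => i j; rewrite mxE; under eq_fun do rewrite mxE.
by rewrite partial_coord; case: (splitP j) => k jk;
  [have -> : j = lshift m k by exact: val_inj|
   have -> : j = rshift n k by exact: val_inj];
  rewrite ?row_mxEl ?row_mxEr mxE ?eq_lrshift// (inj_eq (@lshift_inj _ _)).
Qed.

Lemma state_basisE d (th : 'M[R]_(d, n)) y : th *m dx y = row_mx th 0.
Proof. by rewrite dxE mul_mx_row mulmx1 mulmx0. Qed.

Lemma state_basis_mulmx_tr d (th : 'M[R]_(d, n)) y (X : 'rV[R]_(n + m)) :
  th *m dx y *m X^T = th *m (lsubmx X)^T.
Proof.
by rewrite state_basisE -{1}[X]hsubmxK tr_row_mx mul_row_col mul0mx addr0.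
Qed.

Lemma state_basis_free d (th : 'M[R]_(d, n)) y :
  row_free th -> row_free (th *m dx y).
Proof.
move=> /row_freeP[B thB]; apply/row_freeP; exists (col_mx B 0).
by rewrite state_basisE mul_row_col mul0mx addr0.
Qed.

Lemma state_basis_smooth d (th : 'rV[R]_n -> 'M[R]_(d, n)) p :
  smooth_at (lsubmx p) th -> smooth_at p (fun y => th (lsubmx y) *m dx y).
Proof.
move=> sth; apply: smooth_atM.
  by apply: (smooth_at_comp (f := fun y => lsubmx y)) sth; exact: smooth_lsubmx.
rewrite (_ : @dx R n m = fun=> row_mx 1%:M 0); first exact: smooth_at_cst.
by apply/funext => y; exact: dxE.
Qed.

Lemma directional_lsubmx (X : 'rV[R]_(n + m)) (h : 'rV[R]_n -> R) y :
  smooth_fun_at (lsubmx y) h ->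
  directional (fun=> X) (fun z => h (lsubmx z)) y =
  directional (fun=> lsubmx X) h (lsubmx y).
Proof.
move=> sh; apply: directional_comp => //; first exact: smooth_lsubmx.
move=> r.
have -> : (fun z : 'rV[R]_(n + m) => lsubmx z 0 r) = fun z => z 0 (lshift m r).
  by apply/funext => z; rewrite mxE.
rewrite /directional (bigD1 (lshift m r))//= big1 => [|j jr].
  by rewrite partial_coord eqxx mulr1 addr0 mxE.
by rewrite partial_coord eq_sym (negbTE jr) mulr0.
Qed.

(** The exterior derivative commutes with the pullback along the projection (x, u) -> x; testing on
    constant fields leaves only directional derivatives to compare. *)
Lemma ext_deriv_state_basis d (th : 'rV[R]_n -> 'M[R]_(d, n)) y i
    (X Y : 'rV[R]_(n + m)) : smooth_at (lsubmx y) th ->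
  ext_deriv (fun z => row i (th (lsubmx z) *m dx z)) y X Y =
  ext_deriv (fun x => row i (th x)) (lsubmx y) (lsubmx X) (lsubmx Y).
Proof.
move=> sth.
rewrite ext_deriv_cst; last by apply: smooth_at_row; exact: state_basis_smooth.
rewrite ext_deriv_cst; last exact: smooth_at_row.
have contE (Z : 'rV[R]_(n + m)) :
    (fun z => contract (row i (th (lsubmx z) *m dx z)) Z) =
    (fun z => contract (row i (th (lsubmx z))) (lsubmx Z)).
  by apply/funext => z; rewrite !row_contract state_basis_mulmx_tr.
have scont (Z : 'rV[R]_n) :
    smooth_fun_at (lsubmx y) (fun x => contract (row i (th x)) Z).
  by apply: smooth_contract; [exact: smooth_at_row|exact: smooth_at_cst].
rewrite !contE.
by congr (_ - _); exact: (directional_lsubmx _ (scont _)).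
Qed.

Lemma pfaffian_state_basis d (th : 'rV[R]_n -> 'M[R]_(d, n)) p :
  smooth_at (lsubmx p) th -> pfaffian_at (lsubmx p) th ->
  pfaffian_at p (fun y => th (lsubmx y) *m dx y).
Proof.
move=> sth pth.
have sth' : \forall x \near lsubmx p, smooth_at x th by exact: near_near.
have nsth := near_comp (@smooth_lsubmx R n m p) sth'.
have npth := near_comp (@smooth_lsubmx R n m p) pth.
apply: filterS2 nsth npth => y sy py i X Y.
by rewrite !state_basis_mulmx_tr ext_deriv_state_basis//; exact: py.
Qed.

End StateCodistributions.

(** * Vector fields related by f *)

Section RelatedFields.
Variables (R : realType) (N n : nat) (f : 'rV[R]_N -> 'rV[R]_n).
Variable p : 'rV[R]_N.

Lemma differentials_mulmx_tr v y i :
  (differentials f y *m (v y)^T) i 0 = directional v (fun z => f z 0 i) y.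
Proof. by rewrite mxE; apply: eq_bigr => j _; rewrite !mxE mulrC. Qed.

Definition f_related (v : 'rV[R]_N -> 'rV[R]_N) (a : 'rV[R]_n -> 'rV[R]_n) :=
  \forall y \near p, differentials f y *m (v y)^T = (a (f y))^T.

(** Evaluated on the components of f: [v, w] f^i = v(w f^i) - w(v f^i) = v(b^i o f) - w(a^i o f),
    which is the i-th component of [a, b] at f(y). *)
Lemma f_related_lie_bracket v w a b :
  smooth_at p f -> smooth_at p v -> smooth_at p w ->
  smooth_at (f p) a -> smooth_at (f p) b ->
  f_related v a -> f_related w b ->
  f_related (lie_bracket v w) (lie_bracket a b).
Proof.
move=> sf sv sw sa sb va wb.
have sv' : \forall y \near p, smooth_at y v by exact: near_near.
have sw' : \forall y \near p, smooth_at y w by exact: near_near.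
have sf' : \forall y \near p, smooth_at y f by exact: near_near.
have sa' : \forall y \near p, smooth_at (f y) a.
  exact: (near_comp (P := fun x => smooth_at x a) sf (near_near sa)).
have sb' : \forall y \near p, smooth_at (f y) b.
  exact: (near_comp (P := fun x => smooth_at x b) sf (near_near sb)).
have va' := near_near va; have wb' := near_near wb.
rewrite /f_related; near=> y.
have svy : smooth_at y v by near: y.
have swy : smooth_at y w by near: y.
have sfy : smooth_at y f by near: y.
have say : smooth_at (f y) a by near: y.
have sby : smooth_at (f y) b by near: y.
have vay : \forall z \near y, differentials f z *m (v z)^T = (a (f z))^T by near: y.
have wby : \forall z \near y, differentials f z *m (w z)^T = (b (f z))^T by near: y.
have dirE u c : (\forall z \near y, differentials f z *m (u z)^T = (c (f z))^T) ->
    forall r, \forall z \near y, directional u (fun z => f z 0 r) z = c (f z) 0 r.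
  by move=> uc r; apply: filterS uc => z E; rewrite -differentials_mulmx_tr E mxE.
apply/matrixP => i j; rewrite ord1 differentials_mulmx_tr !mxE.
have /smooth_atP sfy' := sfy; rewrite directional_lie_bracket//.
rewrite (directional_near_eq _ (dirE _ _ wby i)).
rewrite (directional_near_eq _ (dirE _ _ vay i)).
have /smooth_atP say' := say; have /smooth_atP sby' := sby.
(* A directional derivative sees only the value of the field at the point, so the constant field
   [a (f y)] stands for [a]. *)
rewrite (@directional_comp _ _ _ v f (a (f y)) (fun z => b z 0 i))//; last first.
  by move=> r; exact: nbhs_singleton (dirE _ _ vay r).
rewrite (@directional_comp _ _ _ w f (b (f y)) (fun z => a z 0 i))//.
by move=> r; exact: nbhs_singleton (dirE _ _ wby r).
Unshelve. all: by end_near. Qed.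

End RelatedFields.

Lemma smooth_lsubmx_fun (R : realType) N (p : 'rV[R]_N) a b c
    (F : 'rV[R]_N -> 'M[R]_(a, b + c)) :
  smooth_at p F -> smooth_at p (fun z => lsubmx (F z)).
Proof.
by move=> /smooth_atP sF; apply/smooth_atP => i j; under eq_fun do rewrite mxE.
Qed.

Lemma smooth_rsubmx_fun (R : realType) N (p : 'rV[R]_N) a b c
    (F : 'rV[R]_N -> 'M[R]_(a, b + c)) :
  smooth_at p F -> smooth_at p (fun z => rsubmx (F z)).
Proof.
by move=> /smooth_atP sF; apply/smooth_atP => i j; under eq_fun do rewrite mxE.
Qed.

(** * Smooth generators of the kernel *)

Section KernelFields.
Variables (R : realType) (n d : nat) (th : 'rV[R]_n -> 'M[R]_(d, n)).
Variable x0 : 'rV[R]_n.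
Hypothesis th_smooth : smooth_at x0 th.
Hypothesis th_free : row_free (th x0).

(* The orthogonal projector onto ker th; its rows generate the vector fields
   annihilated by th. *)
Definition kernel_proj x : 'M[R]_n := (1%:M - rinvmx (th x) *m th x)^T.

Lemma smooth_kernel_proj : smooth_at x0 kernel_proj.
Proof.
apply: smooth_at_tr; apply: smooth_atD; first exact: smooth_at_cst.
by apply: smooth_atN; apply: smooth_atM => //; exact: smooth_rinvmx.
Qed.

Lemma near_kernel_proj : \forall x \near x0, forall j,
  th x *m (row j (kernel_proj x))^T = 0.
Proof.
apply: filterS (near_row_free th_smooth th_free) => x free_x j.
rewrite tr_row /kernel_proj trmxK colE mulmxA mulmxBr mulmx1.
by rewrite mulmxA mulmx_rinvmx// mul1mx subrr mul0mx.
Qed.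

Lemma kernel_projE x (X : 'rV[R]_n) : th x *m X^T = 0 -> X *m kernel_proj x = X.
Proof.
move=> thX; apply: trmx_inj; rewrite trmx_mul /kernel_proj trmxK.
by rewrite mulmxBl mul1mx -mulmxA thX mulmx0 subr0.
Qed.

(** Every vector of ker th at x is a combination of the rows of the projector, and d(omega) is
    bilinear at x; so Cartan's formula is needed for these finitely many fields only. *)
Lemma pfaffian_kernel_brackets :
  (forall j l, \forall x \near x0,
     th x *m (lie_bracket (fun z => row j (kernel_proj z))
                          (fun z => row l (kernel_proj z)) x)^T = 0) ->
  pfaffian_at x0 th.
Proof.
move=> brackets.
have nbrackets : \forall x \near x0, forall j l,
     th x *m (lie_bracket (fun z => row j (kernel_proj z))
                          (fun z => row l (kernel_proj z)) x)^T = 0.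
  by apply: near_forall => j; apply: near_forall => l.
have nker : \forall x \near x0, forall i j, \forall z \near x,
    contract (row i (th z)) (row j (kernel_proj z)) = 0.
  apply: near_forall => i; apply: near_forall => j; apply: near_near.
  by apply: filterS near_kernel_proj => x ker; rewrite row_contract ker mxE.
have nth : \forall x \near x0, smooth_at x th by exact: near_near.
have nproj : \forall x \near x0, smooth_at x kernel_proj.
  exact: near_near smooth_kernel_proj.
rewrite /pfaffian_at; near=> x => i X Y thX thY.
have sth : smooth_at x th by near: x.
have sproj : smooth_at x kernel_proj by near: x.
pose J := \matrix_(k, j) partial k (fun z => row i (th z) 0 j) x.
(* The entries of this matrix are the values of d(omega) on all pairs of generators. *)
suff projJ0 : kernel_proj x *m (J - J^T) *m (kernel_proj x)^T = 0.
  rewrite ext_derivE -/J -(kernel_projE thX) -(kernel_projE thY) trmx_mul.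
  have -> : X *m kernel_proj x *m (J - J^T) *m ((kernel_proj x)^T *m Y^T) =
      X *m (kernel_proj x *m (J - J^T) *m (kernel_proj x)^T) *m Y^T.
    by rewrite !mulmxA.
  by rewrite projJ0 mulmx0 mul0mx mxE.
apply/matrixP => j l; rewrite [RHS]mxE.
have -> : (kernel_proj x *m (J - J^T) *m (kernel_proj x)^T) j l =
    (row j (kernel_proj x) *m (J - J^T) *m (row l (kernel_proj x))^T) 0 0.
  rewrite -row_mul [LHS]mxE [RHS]mxE; apply: eq_bigr => k _.
  by congr (_ * _); rewrite !mxE.
rewrite -(@ext_derivE R n (fun z => row i (th z)) x).
rewrite (@ext_deriv_lie_bracket R n (fun z => row j (kernel_proj z))
  (fun z => row i (th z)) (fun z => row l (kernel_proj z)) x);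
  [|exact: smooth_at_row..].
rewrite directional_near0; last by move: i l {J}; near: x.
rewrite directional_near0; last by move: i j {J}; near: x.
rewrite row_contract (_ : th x *m _ = 0) ?mxE ?subr0//.
by move: j l; near: x.
Unshelve. all: by end_near. Qed.

End KernelFields.

(** * The backward-shift of an integrable codistribution *)

Section BackwardShiftStep.
Variables (R : realType) (n m : nat) (f : 'rV[R]_(n + m) -> 'rV[R]_n).
Variable p : 'rV[R]_(n + m).
Hypothesis f_smooth : smooth_at p f.
Hypothesis f_free : row_free (df f p).
Hypothesis f_fix : f p = lsubmx p.

Let df_smooth : smooth_at p (df f).
Proof. exact: smooth_differentials. Qed.

Let df_free : \forall y \near p, row_free (df f y).
Proof. exact: near_row_free. Qed.

Lemma near_pull (P : set 'rV[R]_n) :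
  (\forall x \near lsubmx p, P x) -> \forall y \near p, P (f y).
Proof. by rewrite -f_fix; exact: near_comp. Qed.

Lemma near_push (P : set 'rV[R]_n) :
  (\forall y \near p, P (f y)) -> \forall x \near lsubmx p, P x.
Proof. by rewrite -f_fix; exact: near_image. Qed.

Lemma smooth_at_pull a b (F : 'rV[R]_n -> 'M[R]_(a, b)) :
  smooth_at (lsubmx p) F -> smooth_at p (fun y => F (f y)).
Proof. by move=> sF; apply: smooth_at_comp; rewrite ?f_fix. Qed.

Lemma pulled_basis_free d (th : 'rV[R]_n -> 'M[R]_(d, n)) Q :
  local_basis p (fun y => th (f y) *m df f y) Q -> row_free (th (lsubmx p)).
Proof.
move=> [_ /nbhs_singleton /row_freeP[B thB] _].
by apply/row_freeP; exists (df f p *m B); rewrite -f_fix mulmxA.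
Qed.

(** [backward_shift] collects the spans given by all bases, so they must be shown to lie in a single
    one. Two bases of Q span the same rows at the points f(y), hence near x0 by [near_push], with
    smooth transition coefficients. *)
Lemma backward_shift_basis d (th : 'rV[R]_n -> 'M[R]_(d, n)) Q :
  smooth_at (lsubmx p) th -> local_basis p (fun y => th (f y) *m df f y) Q ->
  local_basis p (fun y => th (lsubmx y) *m @dx R n m y) (backward_shift f p Q).
Proof.
move=> sth bth; have th_free := pulled_basis_free bth.
split; first exact: state_basis_smooth.
  have nfree : \forall y \near p, row_free (th (lsubmx y)).
    exact: (near_comp (P := fun x => row_free (th x)) (@smooth_lsubmx R n m p)
      (near_row_free sth th_free)).
  by apply: filterS nfree => y; exact: state_basis_free.
apply/seteqP; split=> w; last by move=> sw; exists d, th.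
move=> [d' [th' [sth' bth']]].
have sub : \forall x \near lsubmx p, (th' x <= th x)%MS.
  apply: near_push.
  apply: filterS2 df_free (local_basis_eqmx bth' bth) => y freey thE.
  have : (th' (f y) *m df f y <= th (f y) *m df f y)%MS by rewrite thE.
  by rewrite submxMfree.
have sC : smooth_at (lsubmx p) (fun x => th' x *m rinvmx (th x)).
  by apply: smooth_atM => //; exact: smooth_rinvmx.
apply: (@span_at_sub _ _ _ _ _ _ _
  (fun y => th' (lsubmx y) *m rinvmx (th (lsubmx y)))).
  exact: (smooth_at_comp (F := fun x => th' x *m rinvmx (th x))
    (@smooth_lsubmx R n m p) sC).
have thE : \forall x \near lsubmx p, th' x = th' x *m rinvmx (th x) *m th x.
  apply: filterS2 (near_row_free sth th_free) sub => x freex subx.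
  by rewrite submx_rinvmx.
have := near_comp (P := fun x => th' x = th' x *m rinvmx (th x) *m th x)
  (@smooth_lsubmx R n m p) thE.
by apply: filterS => y E; rewrite mulmxA -E.
Qed.

Variable P : set ('rV[R]_(n + m) -> 'rV[R]_(n + m)).

(* The f-related fields annihilated by P and span df meet; the minimality of
   codist_plus is tested against the codistribution they annihilate. *)
Definition projectable_field (v : 'rV[R]_(n + m) -> 'rV[R]_(n + m)) :=
  [/\ smooth_at p v,
      exists2 a, smooth_at (lsubmx p) a & f_related f p v a &
      forall w, P w -> span_at p (df f) w ->
        \forall y \near p, contract (w y) (v y) = 0].

Lemma annihilator_related v : annihilator p (df f) v ->
  f_related f p v (fun=> 0).
Proof.
move=> [_ kv]; apply: filterS kv => y kv; apply/matrixP => i j.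
have := kv i; rewrite contractC row_contract ord1 => ->.
by rewrite !mxE.
Qed.

Lemma span_df_annihilated v w : f_related f p v (fun=> 0) ->
  span_at p (df f) w -> \forall y \near p, contract (w y) (v y) = 0.
Proof.
move=> dv [c _ wE]; apply: filterS2 wE dv => y wE dv.
by rewrite contractE wE -mulmxA dv trmx0 mulmx0 mxE.
Qed.

Lemma codist_plus_annihilated w v : smooth_at p w ->
  codist_plus f p P w -> projectable_field v ->
  \forall y \near p, contract (w y) (v y) = 0.
Proof.
move=> sw Pw pv.
pose A := [set om | smooth_at p om /\ forall v, projectable_field v ->
  \forall y \near p, contract (om y) (v y) = 0].
suff [_] : A w by exact.
apply: Pw.
- split=> [om []//|d W AW om [c sc omE]]; split.
    have sW : smooth_at p W by apply: smooth_at_rows => i; have [] := AW i.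
    by apply: (span_at_smooth sW); exists c.
  move=> u pu.
  have AWu : \forall y \near p, forall i, contract (row i (W y)) (u y) = 0.
    by apply: near_forall => i; have [_] := AW i; exact.
  apply: filterS2 omE AWu => y -> AWu.
  rewrite contractE -mulmxA (_ : W y *m _ = 0) ?mulmx0 ?mxE//.
  by apply/matrixP => i j; rewrite ord1 -row_contract AWu mxE.
- move=> om [Pom dom]; split; first exact: span_at_smooth dom.
  by move=> u [_ _]; exact.
(* Invariance: (L_e om)(u) = e(om(u)) - om([e, u]). The first term vanishes since om(u) = 0 near p,
   the second once [e, u] is known to be in the test family. *)
move=> e om Ee [som Aom]; have [se _] := Ee.
split; first exact: smooth_lie_form.
move=> u pu; have [su [a sa ua] _] := pu.
have e0 := annihilator_related Ee.
have eu : f_related f p (lie_bracket e u) (fun=> 0).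
  have sa' : smooth_at (f p) a by rewrite f_fix.
  have := f_related_lie_bracket f_smooth se su (smooth_at_cst _ 0) sa' e0 ua.
  apply: filterS => y ->; congr (_^T); apply/rowP => i; rewrite !mxE.
  by rewrite /directional !big1 ?subr0// => j _;
    rewrite ?partial_cst ?mulr0// mxE mul0r.
(* Being related to [0, a] = 0, the bracket kills all of span{df}, and so the meet. *)
have peu : projectable_field (lie_bracket e u).
  split; first exact: smooth_lie_bracket.
    by exists (fun=> 0) => //; exact: smooth_at_cst.
  by move=> w' _; exact: span_df_annihilated.
have som' : \forall y \near p, smooth_at y om by exact: near_near.
have se' : \forall y \near p, smooth_at y e by exact: near_near.
have su' : \forall y \near p, smooth_at y u by exact: near_near.
have ku := near_near (Aom _ pu).
have kb := Aom _ peu.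
near=> y; rewrite contract_lie_form; [|by near: y..].
rewrite directional_near0; last by near: y.
by rewrite (near kb y)// subr0.
Unshelve. all: by end_near. Qed.

(** A field of ker th is lifted directly into P^perp by solving W x = 0, df x = a(f) smoothly.
    Solvability is where the inclusion of the meet in P^+ is used. *)
Lemma near_kernel_lift d (W : 'rV[R]_(n + m) -> 'M[R]_(d, n + m)) d'
    (th : 'rV[R]_n -> 'M[R]_(d', n)) a :
  local_basis p W P ->
  (\forall y \near p,
     \rank (col_mx (W y) (df f y)) = \rank (col_mx (W p) (df f p))) ->
  smooth_at (lsubmx p) th ->
  local_basis p (fun y => th (f y) *m df f y) (codist_plus f p P) ->
  smooth_at (lsubmx p) a -> (\forall x \near lsubmx p, th x *m (a x)^T = 0) ->
  exists2 v, projectable_field v &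
    f_related f p v a /\ \forall y \near p, W y *m (v y)^T = 0.
Proof.
move=> [sW freeW PW] rk sth [sTh freeTh PTh] sa tha.
have saf := smooth_at_pull sa.
have sI := smooth_rinvmx df_smooth f_free.
pose v y := (rinvmx (df f y) *m (a (f y))^T)^T.
have va : \forall y \near p, df f y *m (v y)^T = (a (f y))^T.
  by apply: filterS df_free => y freey; rewrite trmxK mulmxA mulmx_rinvmx ?mul1mx.
(* A form of the meet is in P^+, hence a combination of the rows of th(f) df; these kill the
   uncorrected lift [v] because th kills a. *)
have kv w : P w -> span_at p (df f) w -> \forall y \near p, w y *m (v y)^T = 0.
  move=> Pw dw; have : codist_plus f p P w by move=> A _ PA _; exact: PA.
  rewrite PTh => -[c _ wE].
  apply: filterS3 wE va (near_pull tha) => y -> va thay.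
  by rewrite -!mulmxA va thay mulmx0.
have [|||x sx xE] := @smooth_solve R (n + m) p (d + n) (n + m)
    (fun y => col_mx (W y) (df f y)) (fun y => col_mx 0 (a (f y))^T) _ _ rk.
- exact: smooth_at_col_mx.
- apply: smooth_at_col_mx; first exact: smooth_at_cst.
  exact: smooth_at_tr.
(* A smooth relation (l, r) between the rows gives r df = - l W, a form of the meet; so r a(f) = r
   df v = 0, which is the compatibility of the right-hand side. *)
- move=> k sk kM.
  have kMsplit : \forall y \near p, rsubmx (k y) *m df f y = - lsubmx (k y) *m W y.
    apply: filterS kM => y; rewrite -{1}[k y]hsubmxK mul_row_col => /eqP.
    by rewrite addrC addr_eq0 mulNmx => /eqP.
  have sl := smooth_lsubmx_fun sk; have sr := smooth_rsubmx_fun sk.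
  have Pw : P (fun y => rsubmx (k y) *m df f y).
    by rewrite PW; exists (fun y => - lsubmx (k y)) => //; exact: smooth_atN.
  have dw : span_at p (df f) (fun y => rsubmx (k y) *m df f y).
    by exists (fun y => rsubmx (k y)) => //; exact: near_all.
  apply: filterS2 (kv _ Pw dw) va => y kvy va.
  by rewrite -{1}[k y]hsubmxK mul_row_col mulmx0 add0r -va mulmxA.
have xW : \forall y \near p, W y *m x y = 0 /\ df f y *m x y = (a (f y))^T.
  by apply: filterS xE => y; rewrite mul_col_mx => /eq_col_mx.
exists (fun y => (x y)^T); last first.
  by split; apply: filterS xW => y []; rewrite trmxK.
split; first exact: smooth_at_tr.
- by exists a => //; apply: filterS xW => y []; rewrite trmxK.
- move=> w Pw dw; move: Pw; rewrite PW => -[c _ wE].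
  apply: filterS2 wE xW => y -> [Wx _].
  by rewrite contractE trmxK -mulmxA Wx mulmx0 mxE.
Qed.

Lemma pfaffian_backward_shift d (W : 'rV[R]_(n + m) -> 'M[R]_(d, n + m)) d'
    (th : 'rV[R]_n -> 'M[R]_(d', n)) :
  local_basis p W P -> pfaffian_at p W ->
  (\forall y \near p,
     \rank (col_mx (W y) (df f y)) = \rank (col_mx (W p) (df f p))) ->
  smooth_at (lsubmx p) th ->
  local_basis p (fun y => th (f y) *m df f y) (codist_plus f p P) ->
  pfaffian_at (lsubmx p) th.
Proof.
move=> bW pW rk sth bTh; have th_free := pulled_basis_free bTh.
apply: pfaffian_kernel_brackets => // j l.
have sker i := smooth_at_row i (smooth_kernel_proj sth th_free).
have kerE i : \forall x \near lsubmx p,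
    th x *m (row i (kernel_proj th x))^T = 0.
  by apply: filterS (near_kernel_proj sth th_free) => x; apply.
have [v [sv pv1 pv2] [va Wv]] := near_kernel_lift bW rk sth bTh (sker j) (kerE j).
have [w [sw pw1 pw2] [wa Ww]] := near_kernel_lift bW rk sth bTh (sker l) (kerE l).
have [sW _ PW] := bW.
pose a x := row j (kernel_proj th x); pose b x := row l (kernel_proj th x).
have sa : smooth_at (f p) a by rewrite f_fix; exact: sker.
have sb : smooth_at (f p) b by rewrite f_fix; exact: sker.
have rel := f_related_lie_bracket f_smooth sv sw sa sb va wa.
have pvw : projectable_field (lie_bracket v w).
  split; first exact: smooth_lie_bracket.
    by exists (lie_bracket a b) => //; rewrite -f_fix; exact: smooth_lie_bracket.
  move=> u; rewrite PW => -[c _ uE] _.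
  apply: filterS2 uE (pfaffian_lie_bracket sW pW sv sw Wv Ww) => y -> Wvw.
  by rewrite contractE -mulmxA Wvw mulmx0 mxE.
(* The bracket of the lifts only informs about [a, b] at points of the form f(y). *)
apply: near_push.
have [sTh _ PTh] := bTh.
have killed : \forall y \near p, forall i,
    contract (row i (th (f y) *m df f y)) (lie_bracket v w y) = 0.
  apply: near_forall => i; apply: codist_plus_annihilated => //.
    exact: (smooth_at_row i sTh).
  by rewrite PTh; exact: span_at_row.
apply: filterS2 killed rel => y killed_y rel_y.
rewrite -rel_y mulmxA; apply/matrixP => i k.
by rewrite ord1 -row_contract killed_y mxE.
Qed.

End BackwardShiftStep.

(** The sum of two spaces and their meet have complementary dimensions, so a meet of constant rank
    gives a stacked matrix of constant rank, for any choice of bases. *)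
Lemma rank_col_mx_near (R : realType) N (p : 'rV[R]_N) d e
    (W : 'rV[R]_N -> 'M[R]_(d, N)) (F : 'rV[R]_N -> 'M[R]_(e, N)) P Q :
  local_basis p W P -> local_basis p F Q -> const_dim_meet p P Q ->
  \forall y \near p, \rank (col_mx (W y) (F y)) = \rank (col_mx (W p) (F p)).
Proof.
move=> bW bF [d' [e' [V [G [bV bG rk]]]]].
have WV := local_basis_eqmx bW bV; have FG := local_basis_eqmx bF bG.
have [_ freeW _] := bW; have [_ freeF _] := bF.
have rank_colE y : row_free (W y) -> row_free (F y) ->
    (W y :=: V y)%MS -> (F y :=: G y)%MS ->
    \rank (col_mx (W y) (F y)) = (d + e - \rank (V y :&: G y)%MS)%N.
  move=> freeWy freeFy WVy FGy.
  have := mxrank_sum_cap (W y) (F y).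
  rewrite (eqP freeWy) (eqP freeFy) addsmxE => rankE.
  by rewrite -(cap_eqmx WVy FGy) -[RHS](congr1 (subn^~ _) rankE) addnK.
have rank_p := rank_colE p (nbhs_singleton freeW) (nbhs_singleton freeF)
  (nbhs_singleton WV) (nbhs_singleton FG).
near=> y; rewrite rank_p rank_colE; [|by near: y..].
by congr (_ - _)%N; near: y; exact: rk.
Unshelve. all: by end_near. Qed.

(** * Induction along the sequence *)

Lemma dx_basis (R : realType) n m (p : 'rV[R]_(n + m)) :
  local_basis p (@dx R n m) (span_at p (@dx R n m)).
Proof.
have mul1dx : @dx R n m = fun y => 1%:M *m dx y.
  by apply/funext => y; rewrite mul1mx.
split=> //; rewrite mul1dx.
  by apply: (state_basis_smooth (th := fun=> 1%:M)); exact: smooth_at_cst.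
by apply: near_all => y; apply: state_basis_free; rewrite -row_leq_rank mxrank1.
Qed.

Lemma dx_pfaffian (R : realType) n m (p : 'rV[R]_(n + m)) :
  pfaffian_at p (@dx R n m).
Proof.
apply: near_all => y i X Y _ _; rewrite /ext_deriv big1// => k _.
rewrite big1// => j _; under eq_fun do rewrite dxE.
by rewrite partial_cst mul0r.
Qed.

Theorem proposition19 (R : realType) (n m : nat)
    (f : 'rV[R]_(n + m) -> 'rV[R]_n) (x0 : 'rV[R]_n) (u0 : 'rV[R]_m)
    (f_smooth : smooth_at (row_mx x0 u0) f)
    (f_equilibrium : f (row_mx x0 u0) = x0)
    (f_rank : \forall y \near row_mx x0 u0, \rank (df f y) = n)
    (kbar : nat)
    (dims : constant_dimensions f (row_mx x0 u0) kbar)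
    (stop : stops_at f (row_mx x0 u0) kbar) :
  forall k, (1 <= k <= kbar)%N ->
    integrable_codist (row_mx x0 u0) (codist_seq f (row_mx x0 u0) k).
Proof.
set p := row_mx x0 u0 in f_smooth f_equilibrium f_rank dims stop *.
have f_free : row_free (df f p) by rewrite /row_free (nbhs_singleton f_rank).
have f_fix : f p = lsubmx p by rewrite f_equilibrium row_mxKl.
have df_smooth : smooth_at p (df f) by exact: smooth_differentials.
suff pfaffian k : (1 <= k <= kbar)%N ->
    exists d (W : 'rV[R]_(n + m) -> 'M[R]_(d, n + m)),
    local_basis p W (codist_seq f p k) /\ pfaffian_at p W.
  by move=> k /pfaffian[d [W [bW pW]]]; exact: pfaffian_integrable bW pW.
case: k => [//|k]; elim: k => [_|k IH /andP[_ kbarP]].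
  by exists n, (@dx R n m); split; [exact: dx_basis|exact: dx_pfaffian].
have k1 : (1 <= k.+1 <= kbar)%N by rewrite /= ltnW.
have [d [W [bW pW]]] := IH k1.
have [_ meetP _ [d0 [W0 [_ _ W0P]]]] := dims k.+1 k1.
have bdf : local_basis p (df f) (span_at p (df f)).
  by split=> //; exact: near_row_free.
have rk := rank_col_mx_near bW bdf meetP.
(* The zero form belongs to P_(k+2), which has a basis by the dimension hypothesis at k+1.
   Membership of any form in the backward-shift provides a basis th(f) df of P^+. *)
have : codist_seq f p k.+2 (fun=> 0).
  rewrite W0P; exists (fun=> 0); first exact: smooth_at_cst.
  by apply: near_all => y; rewrite mul0mx.
move=> [d' [th [sth bth _]]].
exists d', (fun y => th (lsubmx y) *m dx y); split.
  exact: backward_shift_basis.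
apply: pfaffian_state_basis => //.
exact: (pfaffian_backward_shift f_smooth f_free f_fix bW pW rk sth bth).
Qed.
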